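(* For every full-dimensional convex polyhedron $P\subset\mathbb R^3$, \[ \delta(P)=\sum_{\{F,G\}\in\mathcal O_{\rm ex}(P)}\bigl(e(F)e(G)-(v(F)-1)(v(G)-1)\bigr). \] Equivalently, \[ \delta(P)=N_{EF}^{\rm ex}(P)+\sum_{\{F,G\}\in FF^{\rm ex}(P)}\bigl(e(F)+e(G)-1\bigr), \] where $N_{EF}^{\rm ex}(P)$ is the number of pairs $\{F,G\}\in\mathcal O_{\rm ex}(P)$ consisting of an edge and a facet, and $FF^{\rm ex}(P)$ is the set of pairs $\{F,G\}\in\mathcal O_{\rm ex}(P)$ consisting of two facets.
   Context: A convex polyhedron $P\subset\mathbb R^3$ means a compact full-dimensional convex polytope. Two points of $P$ are antipodal if there are two parallel supporting planes of $P$, one through each point, that contain $P$ between them. $V(P)$ is the number of vertices of $P$; $A(P)$ is the number of unordered pairs of distinct vertices of $P$ that are antipodal; $B(P)$ is the number of unordered pairs of distinct edges of $P$ whose midpoints are antipodal. The antipodal defect is $\delta(P)=V(P)-1-A(P)+B(P)$. For $u\in S^2$, $F_P(u)=\{x\in P:\langle u,x\rangle=\max_{y\in P}\langle u,y\rangle\}$ is the support face in direction $u$. $\mathcal O_{\rm ex}(P)$ is the set of unordered pairs $\{F,G\}$ of proper (nonempty) faces of $P$ such that $\{F,G\}=\{F_P(u),F_P(-u)\}$ for some $u\in S^2$ (exact opposite face pairs). For a face $F$, $v(F)$ and $e(F)$ are the numbers of vertices and edges of $F$; thus a vertex has $v=1,e=0$, an edge has $v=2,e=1$, and an $m$-gonal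 facet has $v=e=m$. *)

(* Defs.v *)
From HB Require Import structures.
From mathcomp Require Import all_boot all_order all_algebra finmap.
From mathcomp Require Import mathcomp_extra boolp classical_sets functions.
From mathcomp Require Import cardinality fsbigop reals.

Set Implicit Arguments.
Unset Strict Implicit.
Unset Printing Implicit Defensive.
Import Order.TTheory GRing.Theory Num.Theory.

Local Open Scope classical_set_scope.
Local Open Scope ring_scope.

Section Polytopes.
Variables (R : realType) (n : nat).
Implicit Types (u x y m : 'rV[R]_n) (P F G E : set 'rV[R]_n).

Definition dot u x : R := \sum_i u 0 i * x 0 i.

Definition unit_sphere : set 'rV[R]_n := [set u | dot u u = 1].

Definition convex_hull k (a : 'I_k -> 'rV[R]_n) : set 'rV[R]_n :=
  [set x | exists w : 'I_k -> R,
    [/\ forall i, 0 <= w i, \sum_i w i = 1 & x = \sum_i w i *: a i]].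

Definition polytope P := exists k (a : 'I_k -> 'rV[R]_n), P = convex_hull a.

(* F has affine dimension d: x0 and the points x0 + row i W (i < d) lie in F,
   are affinely independent, and affinely span F. *)
Definition affine_dim F (d : nat) :=
  exists (x0 : 'rV[R]_n) (W : 'M[R]_(d, n)),
    [/\ F x0, row_free W, forall i, F (x0 + row i W)
      & forall x, F x -> (x - x0 <= W)%MS].

Definition support_face P u : set 'rV[R]_n :=
  [set x | P x /\ forall y, P y -> dot u y <= dot u x].

(* The direction 0 is allowed, so that P is a face of itself; thus an edge
   has itself as its only edge, and a singleton has itself as its only vertex. *)
Definition faces P : set (set 'rV[R]_n) :=
  [set F | F !=set0 /\ exists u, F = support_face P u].

Definition proper_faces P : set (set 'rV[R]_n) :=
  [set F | faces P F /\ F <> P].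

Definition vertices P : set 'rV[R]_n := [set x | faces P [set x]].

Definition edges P : set (set 'rV[R]_n) :=
  [set E | faces P E /\ affine_dim E 1].

Definition facets P : set (set 'rV[R]_n) :=
  [set F | faces P F /\ affine_dim F n.-1].

(* The planes dot u = dot u x and dot u = dot u y are parallel, pass through x
   and y, and have P between them. *)
Definition antipodal P x y :=
  [/\ P x, P y & exists2 u, unit_sphere u &
    forall z, P z -> dot u y <= dot u z <= dot u x].

Definition midpoint E m :=
  exists x y, [/\ x <> y, vertices E = [set x; y] & m = 2^-1 *: (x + y)].

End Polytopes.

Definition convex_polyhedron (R : realType) (P : set 'rV[R]_3) :=
  polytope P /\ affine_dim P 3.

(* An unordered pair of distinct objects x, y is encoded as the set
   [set x; y]. *)
Definition ncard (T : choiceType) (A : set T) : nat := #|` fset_set A|%fset.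

Section Counting.
Variable R : realType.
Implicit Types (P F G E : set 'rV[R]_3) (S : set (set 'rV[R]_3)).

Definition nvert P : nat := ncard (vertices P).
Definition nedge P : nat := ncard (edges P).

Definition antipodal_vertex_pairs P : set (set 'rV[R]_3) :=
  [set S | exists x y, [/\ vertices P x, vertices P y, x <> y,
                           antipodal P x y & S = [set x; y]]].

Definition antipodal_edge_pairs P : set (set (set 'rV[R]_3)) :=
  [set S | exists E E', [/\ edges P E, edges P E', E <> E',
     exists m m', [/\ midpoint E m, midpoint E' m' & antipodal P m m']
     & S = [set E; E']]].

Definition antipodal_defect P : int :=
  (nvert P)%:Z - 1 - (ncard (antipodal_vertex_pairs P))%:Z
    + (ncard (antipodal_edge_pairs P))%:Z.

Definition exact_pairs P : set (set (set 'rV[R]_3)) :=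
  [set S | exists F G, [/\ proper_faces P F, proper_faces P G, S = [set F; G]
     & exists2 u, unit_sphere u &
         [set F; G] = [set support_face P u; support_face P (- u)]]].

Definition exact_EF_pairs P : set (set (set 'rV[R]_3)) :=
  [set S | exact_pairs P S /\
     exists E F, [/\ edges P E, facets P F & S = [set E; F]]].

Definition exact_FF_pairs P : set (set (set 'rV[R]_3)) :=
  [set S | exact_pairs P S /\
     exists F G, [/\ facets P F, facets P G & S = [set F; G]]].

(* For S = [set F; G] these are f F * f G and f F + f G, by pair_prodE and
   pair_sumE, as the members of an exact pair are distinct (exact_pair_neq). *)
Definition pair_prod (f : set 'rV[R]_3 -> int) S : int :=
  \big[*%R/1]_(F \in S) f F.
Definition pair_sum (f : set 'rV[R]_3 -> int) S : int := \sum_(F \in S) f F.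

Lemma pair_prodE (f : set 'rV[R]_3 -> int) F G :
  F <> G -> pair_prod f [set F; G] = f F * f G.
Proof.
move=> FG; rewrite /pair_prod fsbigU0 ?fsbig_set1//; try exact: finite_set1.
by move=> H [/= -> /FG].
Qed.

Lemma pair_sumE (f : set 'rV[R]_3 -> int) F G :
  F <> G -> pair_sum f [set F; G] = f F + f G.
Proof.
move=> FG; rewrite /pair_sum fsbigU0 ?fsbig_set1//; try exact: finite_set1.
by move=> H [/= -> /FG].
Qed.

Lemma exact_pair_neq P F G : convex_polyhedron P ->
  exact_pairs P [set F; G] -> F <> G.
Proof.
move=> [_ [x0 [W [Px0 Wfree PW _]]]] [F' [G' [PF' _ FGFG [u uS FGu]]]] FG.
have singl H : [set F'; G'] H -> H = F.
  by rewrite -FGFG -FG setUid => ->.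
have [[[x Fx] _] _] := PF'.
have eF' : F' = F by apply: singl; left.
have eu : support_face P u = F by apply: singl; rewrite FGu; left.
have eNu : support_face P (- u) = F by apply: singl; rewrite FGu; right.
have dotNl y : dot (- u) y = - dot u y.
  by rewrite /dot -sumrN; apply: eq_bigr => i _; rewrite mxE mulNr.
have const y : P y -> dot u y = dot u x.
  move=> Py; apply/eqP; rewrite eq_le; apply/andP; split.
    by move: Fx; rewrite eF' -eu => -[_]; apply.
  by move: Fx; rewrite eF' -eNu => -[_ /(_ y Py)]; rewrite !dotNl lerN2.
have Wu : W *m u^T = 0.
  apply/matrixP => i j; rewrite (ord1 j) !mxE.
  have := const _ (PW i); rewrite -(const _ Px0).
  rewrite /dot; under eq_bigr do rewrite !mxE mulrDr.
  rewrite big_split /= => /eqP; rewrite -subr_eq0 addrAC subrr add0r => /eqP.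
  by apply: etrans; apply: eq_bigr => k _; rewrite !mxE mulrC.
have u0 : u = 0.
  have Wu' : W \in unitmx by rewrite -row_free_unit.
  by apply: trmx_inj; rewrite -[u^T](mulKmx Wu') Wu mulmx0 trmx0.
move: uS; rewrite /unit_sphere /= /dot u0 big1 => [/eqP|i _].
  by rewrite eq_sym oner_eq0.
by rewrite mxE mul0r.
Qed.

End Counting.

(* Main.v *)
(* On a central hyperplane arrangement in R^n, let chi be the Euler
   characteristic: each sign cell counts (-1)^(rank of the forms vanishing on
   it), which is (-1)^n times (-1)^dim.  Cutting a relatively open convex cone
   by one more hyperplane does not change its chi, so such a cone has chi
   (-1)^(codimension); writing [b >= 0] as the complement of [b < 0], a closed
   polyhedral cone that is not a linear subspace has chi 0.

   Take the arrangement of the differences of the points generating P.  For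
   faces F, G of P (one of them possibly replaced by the empty set), the nonzero
   directions u with F inside F_P(u) and G inside F_P(-u) form a closed cone
   minus the origin, whose chi is 1 if it is inhabited and 0 otherwise.  Summing
   over vertices and over pairs of vertices or edges, and using chi[u <> 0] = 2,
   gives
     2 delta(P) = chi[e(F) e(G) - (v(F) - 1) (v(G) - 1)]
   where F = F_P(u) and G = F_P(-u) for u <> 0.  The integrand vanishes unless F
   or G is a facet, and then u ranges over a line minus the origin, of chi 2.
   The second formula also needs v = e for polygons, which is the same argument
   applied to chi[v(F_Q(u))]. *)

Require Import Defs.
From mathcomp Require Import all_boot all_order all_algebra.
From mathcomp Require Import boolp classical_sets cardinality fsbigop reals.
From mathcomp Require Import finmap lra ring zify.

Set Implicit Arguments.
Unset Strict Implicit.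
Unset Printing Implicit Defensive.
Import Order.TTheory GRing.Theory Num.Theory.
Local Open Scope classical_set_scope.
Local Open Scope ring_scope.

(** * The standard inner product on row vectors *)

Section Dot.
Variables (R : realType) (n : nat).
Implicit Types (u v x y : 'rV[R]_n).

Lemma dotC u x : dot u x = dot x u.
Proof. by apply: eq_bigr => i _; rewrite mulrC. Qed.

Lemma dotDl u v x : dot (u + v) x = dot u x + dot v x.
Proof. by rewrite -big_split; apply: eq_bigr => i _; rewrite mxE mulrDl. Qed.

Lemma dotZl c u x : dot (c *: u) x = c * dot u x.
Proof. by rewrite mulr_sumr; apply: eq_bigr => i _; rewrite mxE mulrA. Qed.

Lemma dotDr u x y : dot u (x + y) = dot u x + dot u y.
Proof. by rewrite dotC dotDl !(dotC _ u). Qed.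

Lemma dotZr c u x : dot u (c *: x) = c * dot u x.
Proof. by rewrite dotC dotZl (dotC _ u). Qed.

Lemma dotNl u x : dot (- u) x = - dot u x.
Proof. by rewrite -scaleN1r dotZl mulN1r. Qed.

Lemma dotNr u x : dot u (- x) = - dot u x.
Proof. by rewrite -scaleN1r dotZr mulN1r. Qed.

Lemma dot0l x : dot 0 x = 0.
Proof. by rewrite -(scale0r 0) dotZl mul0r. Qed.

Lemma dotBr u x y : dot u (x - y) = dot u x - dot u y.
Proof. by rewrite dotDr dotNr. Qed.

Lemma dot_sumr (I : finType) (Q : pred I) (f : I -> 'rV[R]_n) u :
  dot u (\sum_(i | Q i) f i) = \sum_(i | Q i) dot u (f i).
Proof.
elim/big_rec2: _ => [|i y1 y2 _ <-]; last by rewrite dotDr.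
by rewrite dotC dot0l.
Qed.

Lemma dot_suml (I : finType) (Q : pred I) (f : I -> 'rV[R]_n) u :
  dot (\sum_(i | Q i) f i) u = \sum_(i | Q i) dot (f i) u.
Proof. by rewrite dotC dot_sumr; apply: eq_bigr => i _; rewrite dotC. Qed.

Lemma dot_mx u x : dot u x = (x *m u^T) 0 0.
Proof. by rewrite mxE; apply: eq_bigr => i _; rewrite mxE mulrC. Qed.

Lemma dotuu_ge0 u : 0 <= dot u u.
Proof. by apply: sumr_ge0 => i _; rewrite -expr2 sqr_ge0. Qed.

Lemma dotuu_eq0 u : dot u u = 0 -> u = 0.
Proof.
move/eqP; rewrite psumr_eq0 => [/allP u0|i _]; last by rewrite -expr2 sqr_ge0.
apply/rowP => i; rewrite mxE; apply/eqP.
by have := u0 i (mem_index_enum _); rewrite -expr2 sqrf_eq0.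
Qed.

Lemma dotuu_gt0 u : u != 0 -> 0 < dot u u.
Proof.
by move=> u0; rewrite lt0r dotuu_ge0 andbT; apply: contra_neq u0 => /dotuu_eq0.
Qed.

(** The columns of [cokermx A] are functionals that vanish on the row space of [A] and jointly
    detect membership in it; one that is nonzero at [x], up to sign, serves as [d]. *)
Lemma nsubmx_dot m (A : 'M[R]_(m, n)) x : ~~ (x <= A)%MS ->
  exists2 d, (forall y, (y <= A)%MS -> dot d y = 0) & 0 < dot d x.
Proof.
have dotE c (y : 'rV_n) :
    dot (col c (cokermx A))^T y = (y *m cokermx A) 0 c.
  by rewrite /dot mxE; apply: eq_bigr => i _; rewrite !mxE mulrC.
rewrite submxE => x0.
have [c xc0] : exists c, (x *m cokermx A) 0 c != 0.
  apply/existsP; apply: contraNT x0; rewrite negb_exists => /forallP x0.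
  apply/eqP/rowP => c; rewrite [RHS]mxE; apply/eqP.
  by rewrite -[_ == _]negbK.
wlog x_gt0 : / 0 < (x *m cokermx A) 0 c => [th|]; last first.
  exists (col c (cokermx A))^T => [y|]; rewrite dotE // submxE => /eqP->.
  by rewrite mxE.
have d0 y : (y <= A)%MS -> (y *m cokermx A) 0 c = 0.
  by rewrite submxE => /eqP->; rewrite mxE.
have [/th//|xc] := ltP 0 ((x *m cokermx A) 0 c).
exists (- (col c (cokermx A))^T) => [y yA|]; rewrite dotNl dotE.
  by rewrite d0 ?oppr0.
by rewrite oppr_gt0 lt_neqAle xc0.
Qed.

End Dot.

(** * Signs of real numbers and their stability *)

Definition sgn3 (R : realType) (x : R) : bool * bool := (0 < x, x < 0).

Section Sign.
Variable R : realType.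
Implicit Types x y c d : R.

Lemma sgn3_eq0 x y : sgn3 x = sgn3 y -> (x == 0) = (y == 0).
Proof. by rewrite !eq_le !leNgt => -[-> ->]. Qed.

Lemma sgn3_pos x : 0 < x -> sgn3 x = (true, false).
Proof. by move=> x0; rewrite /sgn3 x0 ltNge (ltW x0). Qed.

Lemma sgn3_neg x : x < 0 -> sgn3 x = (false, true).
Proof. by move=> x0; rewrite /sgn3 x0 ltNge (ltW x0). Qed.

Lemma sgn3_lin c d x y : 0 < c -> 0 < d -> sgn3 x = sgn3 y ->
  sgn3 (c * x + d * y) = sgn3 y.
Proof.
move=> c0 d0; case: (ltgtP y 0) => [y0|y0|->].
- rewrite (sgn3_neg y0) /sgn3 => -[_ x0]; rewrite -/(sgn3 _) sgn3_neg //; nra.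
- rewrite (sgn3_pos y0) /sgn3 => -[x0 _]; rewrite -/(sgn3 _) sgn3_pos //; nra.
- by move=> xy; rewrite (eqP (_ : x == 0)) ?(sgn3_eq0 xy) // !mulr0 addr0.
Qed.

Lemma sgn3_small x y : `|y| < `|x| -> sgn3 (x + y) = sgn3 x.
Proof.
case: (ltgtP x 0) => [x0|x0|->]; last by rewrite normr0 ltNge normr_ge0.
- rewrite (ltr0_norm x0) ltr_norml => /andP[y1 y2].
  by rewrite !sgn3_neg //; lra.
- rewrite (gtr0_norm x0) ltr_norml => /andP[y1 y2].
  by rewrite !sgn3_pos //; lra.
Qed.

(** One [e] controls finitely many perturbations at once: with [sgn3_small], each nonzero [x i]
    keeps its sign after adding [e * y i]. *)
Lemma small_enough (I : finType) (x y : I -> R) :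
  exists2 e, 0 < e & forall i, x i != 0 -> e * `|y i| < `|x i|.
Proof.
(* The added 1 keeps the denominator positive when [y i] is zero; the 1 in the minimum covers the
   case that every [x i] is zero. *)
pose f i := `|x i| / (`|y i| + 1).
exists (\big[Num.min/1]_(i | x i != 0) f i).
  rewrite lt_bigmin // => i xi; rewrite divr_gt0 ?normr_gt0 //.
  by rewrite ltr_wpDl.
move=> i xi; have y0 := normr_ge0 (y i).
apply: (@le_lt_trans _ _ (f i * `|y i|)).
  by rewrite ler_wpM2r // (bigmin_le_cond _ (fun j => f j)).
rewrite /f -mulrA gtr_pMr ?normr_gt0 // mulrC ltr_pdivrMr; lra.
Qed.

End Sign.

(** * Euler characteristic of a hyperplane arrangement *)

Definition ind (T : Type) (X : set T) (x : T) : int := `[< X x >]%:R.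

Section Arrangement.
Variables (R : realType) (n : nat) (I : finType) (b : I -> 'rV[R]_n).
Implicit Types (u p q w : 'rV[R]_n) (J C N Z : {set I}) (i j : I).
Implicit Types (f g : 'rV[R]_n -> int).

(** The values lie in a finite type, so that [chi] is a finite sum; the sign zero is
    [(false, false)]. *)
Definition sgnv u : {ffun I -> bool * bool} := [ffun i => sgn3 (dot u (b i))].

Definition agree J p u : bool :=
  [forall j in J, sgn3 (dot u (b j)) == sgn3 (dot p (b j))].

(** These are the equations of the relatively open cone of all [u] with [agree J p u], so the rank
    is the codimension of that cone. *)
Definition form_span J p : 'M[R]_n :=
  (\sum_(j | (j \in J) && (dot p (b j) == 0%R)) <<b j>>)%MS.

Definition form_rank J p : nat := \rank (form_span J p).

(** The default 0 matters only for patterns that no vector realizes, and [chi] omits these. *)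
Definition cell_rep (s : {ffun I -> bool * bool}) : 'rV[R]_n :=
  xget 0 [set u | sgnv u = s].

(* The Euler characteristic of f, up to the global sign (-1)^n: the sign cell
   of u is relatively open of dimension n - form_rank setT u. *)
Definition chi f : int :=
  \sum_(s | `[< exists u, sgnv u = s >])
    (-1) ^+ form_rank [set: I]%SET (cell_rep s) * f (cell_rep s).

Lemma cell_repK u : sgnv (cell_rep (sgnv u)) = sgnv u.
Proof. exact: (@xgetPex _ 0 [set v | sgnv v = sgnv u] (ex_intro _ u erefl)).
  Qed.

Lemma eq_chi f g : f =1 g -> chi f = chi g.
Proof. by move=> fg; apply: eq_bigr => s _; rewrite fg. Qed.

Lemma chiD f g : chi (fun u => f u + g u) = chi f + chi g.
Proof. by rewrite -big_split; apply: eq_bigr => s _; rewrite mulrDr. Qed.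

Lemma chiZ c f : chi (fun u => c * f u) = c * chi f.
Proof. by rewrite mulr_sumr; apply: eq_bigr => s _; rewrite mulrCA. Qed.

Lemma chiB f g : chi (fun u => f u - g u) = chi f - chi g.
Proof.
rewrite -[- chi g]mulN1r -chiZ -chiD.
by apply: eq_chi => u; rewrite mulN1r.
Qed.

Lemma chi_sum (T : Type) (r : seq T) (F : T -> 'rV[R]_n -> int) :
  chi (fun u => \sum_(x <- r) F x u) = \sum_(x <- r) chi (F x).
Proof. by rewrite exchange_big; apply: eq_bigr => s _; rewrite mulr_sumr. Qed.

Lemma chi0 f : (forall u, f u = 0) -> chi f = 0.
Proof. by move=> f0; rewrite /chi big1 // => s _; rewrite f0 mulr0. Qed.

Lemma agreeP J p u :
  reflect {in J, forall j, sgn3 (dot u (b j)) = sgn3 (dot p (b j))}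
    (agree J p u).
Proof.
apply: (iffP forall_inP) => [h j /h/eqP//|h j jJ].
by apply/eqP; exact: h.
Qed.

Lemma agree_refl J p : agree J p p.
Proof. exact/agreeP. Qed.

Lemma agree_sgnv p u : agree [set: I]%SET p u = (sgnv u == sgnv p).
Proof.
apply/agreeP/eqP => [pu|/ffunP pu j _]; last by move: (pu j); rewrite !ffunE.
by apply/ffunP => j; rewrite !ffunE pu.
Qed.

Lemma agreeU1 i J p u : agree (i |: J) p u =
  agree J p u && (sgn3 (dot u (b i)) == sgn3 (dot p (b i))).
Proof.
apply/agreeP/andP => [pu|[/agreeP pu /eqP pui] j /setU1P[->//|/pu//]].
split; last by rewrite pu ?setU11.
by apply/agreeP => j jJ; rewrite pu ?inE ?jJ ?orbT.
Qed.

Lemma agree_eq J p q : agree J p q -> agree J q =1 agree J p.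
Proof.
move=> /agreeP pq u; apply/agreeP/agreeP => uq j jJ.
  by rewrite uq // pq.
by rewrite uq // pq.
Qed.

Lemma form_span_eq J p q : agree J p q -> form_span J q = form_span J p.
Proof.
move=> /agreeP pq; apply: eq_bigl => j.
by case jJ: (j \in J) => //=; rewrite (sgn3_eq0 (pq j jJ)).
Qed.

Lemma form_rank_eq J p q : agree J p q -> form_rank J q = form_rank J p.
Proof. by move=> pq; rewrite /form_rank (form_span_eq pq). Qed.

Lemma form_sub J p j : j \in J -> dot p (b j) = 0 -> (b j <= form_span J p)%MS.
Proof.
move=> jJ pj; apply: (sumsmx_sup j); last by rewrite genmxE.
by rewrite jJ pj eqxx.
Qed.

Lemma form_spanP J p m (A : 'M_(m, n)) :
  reflect (forall j, j \in J -> dot p (b j) = 0 -> (b j <= A)%MS)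
    (form_span J p <= A)%MS.
Proof.
apply: (iffP sumsmx_subP) => h j; first by
  move=> jJ /eqP pj; have := h j; rewrite jJ pj genmxE => /(_ isT).
by move=> /andP[jJ /eqP pj]; rewrite genmxE h.
Qed.

Lemma dot_kermx u x : (x <= kermx u^T)%MS = (dot u x == 0).
Proof.
rewrite dot_mx; apply/sub_kermxP/eqP => [->|ux]; first by rewrite mxE.
by apply/matrixP => i j; rewrite !ord1 ux mxE.
Qed.

Lemma dot_form_span J p u x : agree J p u -> (x <= form_span J p)%MS ->
  dot u x = 0.
Proof.
move=> /agreeP pu xW; apply/eqP; rewrite -dot_kermx (submx_trans xW) //.
apply/form_spanP => j jJ pj.
by rewrite dot_kermx (sgn3_eq0 (pu j jJ)) pj.
Qed.

Lemma agreeU J J' p u : agree (J :|: J') p u = agree J p u && agree J' p u.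
Proof.
apply/agreeP/andP => [pu|[/agreeP pJ /agreeP pJ'] j /setUP[/pJ|/pJ']//].
by split; apply/agreeP => j jJ; rewrite pu // inE jJ ?orbT.
Qed.

Lemma form_spanU J J' p :
  (form_span (J :|: J') p :=: form_span J p + form_span J' p)%MS.
Proof.
apply/eqmxP/andP; split; last first.
  rewrite addsmx_sub; apply/andP; split; apply/form_spanP => j jJ pj;
  by rewrite form_sub // inE jJ ?orbT.
apply/form_spanP => j /setUP[jJ pj|jJ pj].
  by rewrite (submx_trans (form_sub jJ pj)) ?addsmxSl.
by rewrite (submx_trans (form_sub jJ pj)) ?addsmxSr.
Qed.

Lemma form_rankU1 i J p : i \notin J -> form_rank (i |: J) p =
  if (dot p (b i) == 0) && ~~ (b i <= form_span J p)%MS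
  then (form_rank J p).+1 else form_rank J p.
Proof.
move=> iJ; have sub : (form_span J p <= form_span (i |: J) p)%MS.
  by apply/form_spanP => j jJ pj; rewrite form_sub // !inE jJ orbT.
case: eqP => pi /=; last first.
  apply/eqP; rewrite eqn_leq (mxrankS sub) andbT; apply: mxrankS.
  by apply/form_spanP => j /setU1P[-> //|]; exact: form_sub.
have eW : (form_span (i |: J) p :=: b i + form_span J p)%MS.
  apply/eqmxP/andP; split; last first.
    by rewrite addsmx_sub sub andbT form_sub ?setU11.
  apply/form_spanP => j /setU1P[-> _|jJ pj]; first exact: addsmxSl.
  by rewrite (submx_trans (form_sub jJ pj)) ?addsmxSr.
rewrite /form_rank eW; case: ifPn => [biW|/negbNE biW]; last first.
  by rewrite (addsmx_idPr biW).
apply/eqP; rewrite eqn_leq; apply/andP; split.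
  apply: (leq_trans (mxrank_adds_leqif _ _));
    exact: (leq_add (rank_leq_row (b i)) (leqnn _)).
rewrite ltn_neqAle mxrankS ?addsmxSr // andbT.
apply: contraNneq biW => /eqP.
by rewrite (mxrank_leqif_sup (addsmxSr _ _)) addsmx_sub => /andP[].
Qed.

Lemma agree_lin J p u v (c d : R) : 0 < c -> 0 < d ->
  agree J p u -> agree J p v -> agree J p (c *: u + d *: v).
Proof.
move=> c0 d0 /agreeP pu /agreeP pv; apply/agreeP => j jJ.
by rewrite dotDl !dotZl sgn3_lin // ?pv // pu.
Qed.

(** A direction annihilated by the forms vanishing at [p] keeps them at zero, and a short enough
    step keeps the signs of the others. *)
Lemma agree_perturb J p d : (forall x, (x <= form_span J p)%MS ->
  dot d x = 0) ->
  exists2 e : R, 0 < e & agree J p (p + e *: d) /\ agree J p (p - e *: d).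
Proof.
move=> dW.
have [e e0 he] := small_enough (fun j => dot p (b j)) (fun j => dot d (b j)).
exists e => //; split; apply/agreeP => j jJ.
  rewrite dotDl dotZl; have [pj|pj] := eqVneq (dot p (b j)) 0.
    by rewrite dW ?mulr0 ?addr0 // form_sub.
  by rewrite sgn3_small // normrM gtr0_norm ?he.
rewrite dotDl dotNl dotZl; have [pj|pj] := eqVneq (dot p (b j)) 0.
  by rewrite dW ?mulr0 ?subr0 // form_sub.
by rewrite sgn3_small // normrN normrM gtr0_norm ?he.
Qed.

(** The cone is convex: two of its points with opposite signs of [b i] would have a positive
    combination on which [b i] vanishes. *)
Lemma sign_constant J p i :
  (forall u, agree J p u -> dot u (b i) != 0) ->
  forall u, agree J p u -> sgn3 (dot u (b i)) = sgn3 (dot p (b i)).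
Proof.
move=> nz u pu.
have opp v w : agree J p v -> agree J p w -> 0 < dot v (b i) ->
  ~ dot w (b i) < 0.
  move=> pv pw v0 w0; have := nz _ (agree_lin v0 (_ : 0 < - dot w (b i)) pw pv).
  rewrite oppr_gt0 => /(_ w0); rewrite dotDl !dotZl mulNr mulrC.
  by rewrite subrr eqxx.
have pp := agree_refl J p; have u0 := nz _ pu; have p0 := nz _ pp.
case: (ltgtP (dot u (b i)) 0) u0 => // u0 _;
  case: (ltgtP (dot p (b i)) 0) p0 => // p0 _.
- by rewrite !sgn3_neg.
- by case: (opp _ _ pp pu p0 u0).
- by case: (opp _ _ pu pp u0 p0).
- by rewrite !sgn3_pos.
Qed.

(* A partial sign pattern cuts out a relatively open convex cone. *)
Lemma chi_agree J p : chi (fun u => (agree J p u)%:R) = (-1) ^+ form_rank J p.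
Proof.
(* Induction on the number of forms outside [J]; when none is left, the cone is a single sign
   cell. *)
move: {2}#|~: J| (leqnn #|~: J|) p => m; elim: m J => [|m IHm] J.
  rewrite leqn0 cards_eq0 => /eqP JT p.
  have {JT}-> : J = [set: I]%SET by rewrite -[J]finset.setCK JT finset.setC0.
  rewrite /chi (bigD1 (sgnv p)) /=; last by apply/asboolP; exists p.
  have pp : agree [set: I]%SET p (cell_rep (sgnv p)).
    by rewrite agree_sgnv cell_repK.
  rewrite big1 => [|s /andP[/asboolP[u <-] up]]; last first.
    by rewrite agree_sgnv cell_repK (negPf up) mulr0.
  by rewrite addr0 pp mulr1 (form_rank_eq pp).
move=> JC p; have [J0|[i]] := set_0Vmem (~: J).
  by apply: IHm; rewrite J0 cards0.
rewrite inE => iJ.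
have {}IHm q : chi (fun u => (agree (i |: J) q u)%:R) =
    (-1) ^+ form_rank (i |: J) q.
  apply: IHm; move: JC; rewrite (cardsD1 i) inE iJ add1n ltnS.
  by congr (_ <= _)%N; apply: eq_card => j; rewrite !inE negb_or.
(* If [b i] has constant sign on the cone, adding it to [J] leaves the cone as it is. *)
have undivided : (forall u, agree J p u ->
      sgn3 (dot u (b i)) = sgn3 (dot p (b i))) ->
    form_rank (i |: J) p = form_rank J p ->
    chi (fun u => (agree J p u)%:R) = (-1) ^+ form_rank J p.
  move=> sg <-; rewrite -IHm; apply: eq_chi => u; rewrite agreeU1.
  by case pu: agree => //; rewrite sg ?eqxx.
have [biW|biW] := boolP (b i <= form_span J p)%MS.
  apply: undivided => [u pu|]; last by rewrite form_rankU1 // biW andbF.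
  by rewrite !(dot_form_span _ biW) // agree_refl.
(* Without a zero of [b i] in the cone, convexity makes its sign constant. With a zero [q], the
   hyperplane properly cuts the cone, and [d] leads from [q] to both sides. *)
have [[q [pq qi]]|nz] := pselect (exists q, agree J p q /\ dot q (b i) = 0);
  last first.
  have {}nz u : agree J p u -> dot u (b i) != 0.
    by move=> pu; apply/eqP => ui; apply: nz; exists u.
  apply: undivided => [|]; first exact: sign_constant.
  by rewrite form_rankU1 // (negPf (nz _ (agree_refl J p))).
move: (biW); rewrite -(form_span_eq pq) => biWq.
have [d dW di] := nsubmx_dot biWq.
have [e e0 [q1 q2]] := agree_perturb dW.
have s1 : 0 < dot (q + e *: d) (b i) by rewrite dotDl qi add0r dotZl mulr_gt0.
have s2 : dot (q - e *: d) (b i) < 0.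
  by rewrite dotDl qi add0r dotNl dotZl oppr_lt0 mulr_gt0.
have r1 : form_rank (i |: J) (q + e *: d) = form_rank J p.
  by rewrite form_rankU1 // gt_eqF //= (form_rank_eq q1) (form_rank_eq pq).
have r2 : form_rank (i |: J) (q - e *: d) = form_rank J p.
  by rewrite form_rankU1 // lt_eqF //= (form_rank_eq q2) (form_rank_eq pq).
have r0 : form_rank (i |: J) q = (form_rank J p).+1.
  by rewrite form_rankU1 // qi eqxx biWq (form_rank_eq pq).
(* Two open sides of the original rank r and a slice of rank r + 1 contribute (-1)^r in total. *)
suff -> : chi (fun u => (agree J p u)%:R) =
    chi (fun u => (agree (i |: J) q u)%:R) +
    (chi (fun u => (agree (i |: J) (q + e *: d) u)%:R) +
     chi (fun u => (agree (i |: J) (q - e *: d) u)%:R)).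
  by rewrite !IHm r0 r1 r2 exprS mulN1r addKr.
rewrite -!chiD; apply: eq_chi => u;
  rewrite !agreeU1 (agree_eq q1) (agree_eq q2) (agree_eq pq).
case: agree => //=; rewrite qi (sgn3_pos s1) (sgn3_neg s2).
case: (ltgtP (dot u (b i)) 0) => [u0|u0|->].
- by rewrite (sgn3_neg u0) /sgn3 ltxx.
- by rewrite (sgn3_pos u0) /sgn3 ltxx.
- by rewrite /sgn3 ltxx.
Qed.

(** * Polyhedral cones with equalities, weak and strict inequalities *)

Definition mixed_cone Z C N : set 'rV[R]_n :=
  [set u | [/\ forall z, z \in Z -> dot u (b z) = 0,
               forall c, c \in C -> 0 <= dot u (b c)
             & forall j, j \in N -> dot u (b j) < 0]].

(** The cone is the sign pattern of [- w] on [Z :|: N], and among these forms only those of [Z]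
    vanish there. *)
Lemma chi_open_cone Z N w : (forall z, z \in Z -> dot w (b z) = 0) ->
  (forall j, j \in N -> 0 < dot w (b j)) ->
  chi (ind (mixed_cone Z finset.set0 N)) = (-1) ^+ form_rank Z w.
Proof.
move=> wZ wN.
have -> : form_rank Z w = form_rank (Z :|: N) (- w).
  congr (\rank _); apply: eq_bigl => j; rewrite inE dotNl oppr_eq0.
  case: (boolP (j \in Z)) => //= _.
  by case: (boolP (j \in N)) => //= jN; rewrite gt_eqF ?wN.
rewrite -chi_agree; apply: eq_chi => u; congr (_%:R : int); congr nat_of_bool.
apply/asboolP/agreeP => [[uZ _ uN] j /setUP[jZ|jN]|uw].
- by rewrite uZ // dotNl wZ // oppr0.
- by rewrite dotNl !sgn3_neg ?uN // oppr_lt0 wN.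
- split=> [z zZ|c|j jN]; last 2 first.
  + by rewrite inE.
  + have /uw[_] : j \in Z :|: N by rewrite inE jN orbT.
    by rewrite dotNl oppr_lt0 wN.
  + apply/eqP; have /uw/sgn3_eq0-> : z \in Z :|: N by rewrite inE zZ.
    by rewrite dotNl wZ // oppr0.
Qed.

(* Writing [b c >= 0] as the complement of [b c < 0] reduces to open cones,
   all of which have the same dimension because they contain [- w]. *)
Lemma chi_mixed_cone Z C N w : C != finset.set0 ->
  (forall z, z \in Z -> dot w (b z) = 0) ->
  (forall c, c \in C -> 0 < dot w (b c)) ->
  (forall j, j \in N -> 0 < dot w (b j)) ->
  chi (ind (mixed_cone Z C N)) = 0.
Proof.
move: {2}#|C| (erefl #|C|) => m; elim: m C N => [|m IHm] C N.
  by move/eqP; rewrite cards_eq0 => ->.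
move=> Cm /set0Pn[c cC] wZ wC wN.
have -> : chi (ind (mixed_cone Z C N)) = chi (ind (mixed_cone Z (C :\ c) N))
    - chi (ind (mixed_cone Z (C :\ c) (c |: N))).
  rewrite -chiB; apply: eq_chi => u; rewrite /ind.
  have [uZ|uZ] := pselect (mixed_cone Z (C :\ c) N u); last first.
    rewrite !asboolF // => [[H1 H2 H3]|[H1 H2 H3]]; apply: uZ; split=> //.
    - by move=> j jN; rewrite H3 // setU1r.
    - by move=> j /setD1P[_]; exact: H2.
  rewrite (asboolT uZ); case: uZ => H1 H2 H3.
  have [u0|u0] := ltP (dot u (b c)) 0.
    rewrite asboolF => [|[_ /(_ c cC)]]; last by rewrite leNgt u0.
    by rewrite asboolT //; split=> // j /setU1P[->//|]; exact: H3.
  rewrite asboolT => [|]; last first.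
    split=> // j jC; have [->//|jc] := eqVneq j c.
    by rewrite H2 // !inE jc.
  by rewrite asboolF // => -[_ _ /(_ c (setU11 _ _))]; rewrite ltNge u0.
have wC' j : j \in C :\ c -> 0 < dot w (b j) by move/setD1P=> [_ /wC].
have wN' j : j \in c |: N -> 0 < dot w (b j).
  by move/setU1P=> [->|/wN//]; exact: wC.
(* If [c] was the last weak inequality, both pieces are open cones of the same codimension and
   cancel; otherwise both vanish by induction. *)
have [C0|C0] := eqVneq (C :\ c) finset.set0.
  by rewrite C0 !(@chi_open_cone _ _ w) // subrr.
rewrite !IHm ?subr0 //.
- by move: Cm; rewrite (cardsD1 c) cC add1n => -[].
- by move: Cm; rewrite (cardsD1 c) cC add1n => -[].
Qed.

Definition closed_cone C : set 'rV[R]_n :=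
  [set u | forall c, c \in C -> 0 <= dot u (b c)].

(** Constraints that are equalities on the whole cone go into [Z]; a sum of witnesses is strictly
    positive on all others, so [chi_mixed_cone] applies. If [Z] were all of [C], then [- u] would
    lie in the cone. *)
Lemma chi_closed_cone C u : closed_cone C u -> ~ closed_cone C (- u) ->
  chi (ind (closed_cone C)) = 0.
Proof.
move=> Cu CNu.
pose Z := [set c in C | `[< forall v, closed_cone C v ->
  dot v (b c) = 0 >]]%SET.
have wit c : exists v, closed_cone C v /\ (c \in C :\: Z -> 0 < dot v (b c)).
  have [[v [Cv vc]]|nv] := pselect (exists v,
    closed_cone C v /\ 0 < dot v (b c)).
    by exists v.
  (* Here [c] lies in [Z] or outside [C], and [u] is just some point of the cone. *)
  exists u; split=> //; rewrite !inE => /andP[+ cC];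
    rewrite cC /= => /asboolP[].
  move=> v Cv; apply/eqP; rewrite eq_le Cv // andbT leNgt.
  by apply/negP => vc; apply: nv; exists v.
pose v c := sval (cid (wit c)).
have Cv c : closed_cone C (v c) by rewrite /v; case: cid => /= x [].
have vc c : c \in C :\: Z -> 0 < dot (v c) (b c) by rewrite /v;
  case: cid => /= x [].
pose w := \sum_c v c.
have wZ z : z \in Z -> dot w (b z) = 0.
  rewrite inE => /andP[zC /asboolP z0].
  by rewrite dot_suml big1 // => c _; rewrite z0.
have wC c : c \in C :\: Z -> 0 < dot w (b c).
  move=> cCZ; rewrite dot_suml (bigD1 c) //= ltr_pwDl ?vc // sumr_ge0 // => j _.
  by apply: Cv; case/setDP: cCZ.
have -> : chi (ind (closed_cone C)) = chi (ind (mixed_cone Z (C :\: Z)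
  finset.set0)).
  apply: eq_chi => x; congr (_%:R : int); congr nat_of_bool.
  apply/asboolP/asboolP => [Cx|[xZ xC _] c cC].
    split=> [z|c /setDP[/Cx]//|j]; last by rewrite inE.
    by rewrite inE => /andP[_ /asboolP]; apply.
  have [cZ|cZ] := boolP (c \in Z); first by rewrite xZ.
  by rewrite xC // inE cZ.
apply: (@chi_mixed_cone _ _ _ w) => //; last by move=> j; rewrite inE.
apply: contra_notN CNu => /eqP CZ c cC.
have [cZ|cZ] := boolP (c \in Z); last by have := finset.in_setD C Z c;
  rewrite CZ inE cZ cC.
by move: cZ; rewrite inE dotNl => /andP[_ /asboolP->]; rewrite ?oppr0.
Qed.

End Arrangement.

(** * Faces of a convex hull *)

Section Hull.
Variables (R : realType) (n k : nat) (a : 'I_k -> 'rV[R]_n).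
Implicit Types (u w x y z : 'rV[R]_n) (S T : {set 'I_k}) (F G : set 'rV[R]_n).

(** Weights are indexed by all generators and vanish outside [S], so that every face is again a
    [hull] over the same family [a]. *)
Definition hull S : set 'rV[R]_n :=
  [set x | exists w : 'I_k -> R,
    [/\ forall i, 0 <= w i, forall i, i \notin S -> w i = 0, \sum_i w i = 1
      & x = \sum_i w i *: a i]].

Definition argmax S u : {set 'I_k} :=
  [set i in S | [forall j in S, dot u (a j) <= dot u (a i)]]%SET.

Lemma convex_hullE : convex_hull a = hull finset.setT.
Proof.
apply/seteqP; split=> x [w].
  by move=> [w0 w1 ->]; exists w; split=> // i; rewrite inE.
by move=> [w0 _ w1 ->]; exists w.
Qed.

Lemma hull_gen S i : i \in S -> hull S (a i).
Proof.
move=> iS; exists (fun j => (j == i)%:R); split=> [j|j jS| |].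
- by case: (j == i).
- by case: eqP jS => // ->; rewrite iS.
- by rewrite (bigD1 i) //= eqxx big1 ?addr0 // => j /negPf->.
- rewrite (bigD1 i) //= eqxx scale1r big1 ?addr0 // => j /negPf->.
  by rewrite scale0r.
Qed.

Lemma sub_hull S T : S \subset T -> hull S `<=` hull T.
Proof.
move=> /fintype.subsetP ST x [w [w0 wS w1 ->]]; exists w; split=> // i iT.
by apply: wS; apply: contraNN iT; exact: ST.
Qed.

Lemma hull_neq0 S x : hull S x -> exists i, i \in S.
Proof.
move=> [w [_ wS w1 _]]; apply/set0Pn; apply/eqP => S0.
move: w1; rewrite big1 => [/eqP|i _]; first by rewrite eq_sym oner_eq0.
by rewrite wS // S0 inE.
Qed.

Lemma argmaxP S u i :
  reflect (i \in S /\ forall j, j \in S -> dot u (a j) <= dot u (a i))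
    (i \in argmax S u).
Proof.
by rewrite inE; apply: (iffP andP) => -[iS /forall_inP].
Qed.

Lemma argmax_sub S u : argmax S u \subset S.
Proof. by apply/fintype.subsetP => i /argmaxP[]. Qed.

Lemma argmax_ex S u i : i \in S -> exists j, j \in argmax S u.
Proof.
move=> iS; have [j jS jmax] := @arg_maxP _ _ _ i (mem S) (fun j => dot u (a j))
  iS.
by exists j; apply/argmaxP; split.
Qed.

Lemma hull_le S u x c : (forall j, j \in S -> dot u (a j) <= c) -> hull S x ->
  dot u x <= c.
Proof.
move=> uc [w [w0 wS w1 ->]]; rewrite dot_sumr -[c]mul1r -w1 mulr_suml.
apply: ler_sum => i _; rewrite dotZr.
have [iS|/wS->] := boolP (i \in S); last by rewrite !mul0r.
by rewrite ler_wpM2l // uc.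
Qed.

Lemma hull_mid S x y : hull S x -> hull S y -> hull S (2^-1 *: (x + y)).
Proof.
move=> [v [v0 vS v1 ->]] [w [w0 wS w1 ->]];
  exists (fun i => 2^-1 * (v i + w i)).
split=> [i|i iS||]; first by rewrite mulr_ge0 ?invr_ge0 ?addr_ge0.
- by rewrite vS // wS // addr0 mulr0.
- by rewrite -mulr_sumr big_split /= v1 w1 mulVf // pnatr_eq0.
- rewrite -big_split scaler_sumr; apply: eq_bigr => i _.
  by rewrite /= -scalerA scalerDl.
Qed.

(** At a maximizing point the deficits of the generators, averaged with the weights, give zero; each
    term is nonnegative, so nonmaximal generators carry no weight. *)
Lemma support_hull S u : support_face (hull S) u = hull (argmax S u).
Proof.
apply/seteqP; split=> x.
- move=> [Sx xmax]; have [i0 /(argmax_ex u)[i /argmaxP[iS imax]]] := hull_neq0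
  Sx.
  have xi : dot u x = dot u (a i).
    apply/eqP; rewrite eq_le (hull_le imax Sx) /=.
    exact/xmax/hull_gen.
  case: Sx => w [w0 wS w1 xE]; exists w; split=> // j.
  have : \sum_j w j * (dot u (a i) - dot u (a j)) == 0.
    under eq_bigr do rewrite mulrBr -[X in _ - X]dotZr.
    by rewrite sumrB -mulr_suml w1 mul1r -dot_sumr -xE xi subrr.
  have le0 l : true -> 0 <= w l * (dot u (a i) - dot u (a l)).
    have [lS|/wS->] := boolP (l \in S); last by rewrite mul0r.
    by rewrite mulr_ge0 // subr_ge0 imax.
  rewrite (psumr_eq0 _ le0) => /allP/(_ j (mem_index_enum _)) /=.
  rewrite mulf_eq0 => /orP[/eqP//|]; rewrite subr_eq0 => /eqP ij jM.
  apply: wS; apply: contraNN jM => jS; apply/argmaxP; split=> // l lS.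
  by rewrite -ij imax.
- move=> Mx; have Sx := sub_hull (argmax_sub S u) Mx; split=> // y Sy.
  have [i /argmaxP[iS imax]] := hull_neq0 Mx.
  apply: (le_trans (hull_le imax Sy)); rewrite -lerN2 -!dotNl.
  apply: (hull_le _ Mx) => j /argmaxP[_ /(_ _ iS)].
  by rewrite !dotNl lerN2.
Qed.

(** A small tilt of [u] towards [w] preserves strict comparisons and lets [w] decide among ties.
    Hence a face of a face is a face. *)
Lemma argmax_perturb S u w :
  exists2 e : R, 0 < e & argmax S (u + e *: w) = argmax (argmax S u) w.
Proof.
have [e e0 he] := small_enough
  (fun ij : 'I_k * 'I_k => dot u (a ij.1) - dot u (a ij.2))
  (fun ij => dot w (a ij.1) - dot w (a ij.2)).
exists e => //; apply/setP => i.
have sgn j : dot u (a i) != dot u (a j) ->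
    (dot (u + e *: w) (a j) <= dot (u + e *: w) (a i)) =
    (dot u (a j) <= dot u (a i)).
  move=> uij; rewrite -subr_ge0 -[RHS]subr_ge0 !dotDl !dotZl opprD addrACA.
  rewrite -mulrBr !leNgt.
  have lt : `|e * (dot w (a i) - dot w (a j))| < `|dot u (a i) - dot u (a j)|.
    by rewrite normrM (gtr0_norm e0); apply: (he (i, j)); rewrite subr_eq0.
  by have [_ ->] := sgn3_small lt.
have eqv j : dot u (a i) = dot u (a j) ->
    (dot (u + e *: w) (a j) <= dot (u + e *: w) (a i)) =
    (dot w (a j) <= dot w (a i)).
  by move=> uij; rewrite !dotDl !dotZl uij lerD2l ler_pM2l.
apply/argmaxP/argmaxP => [[iS imax]|[/argmaxP[iS imax] iwmax]].
  have iM : i \in argmax S u.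
    apply/argmaxP; split=> // j jS.
    have [->//|/sgn<-] := eqVneq (dot u (a i)) (dot u (a j)); exact: imax.
  split=> // j /argmaxP[jS jmax]; rewrite -eqv ?imax //.
  by apply/eqP; rewrite eq_le jmax //=; case/argmaxP: iM => _; apply.
split=> // j jS; have [uij|/sgn->] := eqVneq (dot u (a i)) (dot u (a j));
  last exact: imax.
by rewrite eqv // iwmax //; apply/argmaxP; split=> // l lS; rewrite -uij imax.
Qed.

Lemma facesP S F : faces (hull S) F <->
  exists u, F = hull (argmax S u) /\ exists i, i \in argmax S u.
Proof.
split=> [[[x Fx] [u Fu]]|[u [-> [i iM]]]].
  rewrite support_hull in Fu; exists u; split=> //; rewrite Fu in Fx.
  exact: hull_neq0 Fx.
split; last by exists u; rewrite support_hull.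
by exists (a i); apply: hull_gen.
Qed.

(** A tilted direction exposes a face of the support face within the whole hull; conversely, a
    direction exposing [G] in the hull also exposes it in the support face. *)
Lemma faces_face S u G : faces (support_face (hull S) u) G <->
  faces (hull S) G /\ G `<=` support_face (hull S) u.
Proof.
split.
  rewrite support_hull => /facesP[w [-> [i iM]]]; split; last first.
    exact/sub_hull/argmax_sub.
  have [e e0 eM] := argmax_perturb S u w; apply/facesP.
  by exists (u + e *: w); rewrite eM; split=> //; exists i.
move=> [[[x Gx] [w GE]] sub]; rewrite GE in Gx sub *; split.
  by exists x.
exists w; apply/seteqP; split=> y.
  by move=> Gy; split; [exact: sub|move=> z [Sz _]; apply: Gy.2].
move=> [Fy ymax]; split; first by case: Fy.
move=> z Sz; apply: (le_trans _ (ymax x (sub x Gx))); exact: Gx.2.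
Qed.

Lemma argmax_support S u i : i \in S ->
  (i \in argmax S u) <-> support_face (hull S) u (a i).
Proof.
move=> iS; split=> [iM|[_ imax]]; first by rewrite support_hull;
  exact: hull_gen.
by apply/argmaxP; split=> // j jS; apply: imax; exact: hull_gen.
Qed.

Lemma sub_argmax S T u : T \subset S ->
  T \subset argmax S u <-> hull T `<=` support_face (hull S) u.
Proof.
move=> /fintype.subsetP TS; rewrite support_hull; split; first exact: sub_hull.
rewrite -support_hull => Tu; apply/fintype.subsetP => i iT.
by apply/argmax_support; [exact: TS|apply: Tu; exact: hull_gen].
Qed.

(** The maximal generators are exactly those lying in the face, so faces can be compared through
    finite index sets. *)
Lemma hull_inj_argmax S u w :
  (hull (argmax S u) = hull (argmax S w)) <-> (argmax S u = argmax S w).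
Proof.
split=> [uw|->//]; apply/eqP; rewrite finset.eqEsubset.
by apply/andP; split; apply/sub_argmax; rewrite ?argmax_sub // support_hull uw.
Qed.

(** * Affine dimension as the rank of the differences of generators *)

Definition gen_span S : 'M[R]_n :=
  (\sum_(ij : 'I_k * 'I_k | (ij.1 \in S) && (ij.2 \in S))
     <<a ij.1 - a ij.2>>)%MS.

Definition gen_rank S : nat := \rank (gen_span S).

Lemma gen_sub S i j : i \in S -> j \in S -> (a i - a j <= gen_span S)%MS.
Proof.
move=> iS jS; apply: (sumsmx_sup (i, j)); last by rewrite genmxE.
by rewrite /= iS jS.
Qed.

Lemma gen_spanP S m (A : 'M_(m, n)) :
  reflect (forall i j, i \in S -> j \in S -> (a i - a j <= A)%MS)
    (gen_span S <= A)%MS.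
Proof.
apply: (iffP sumsmx_subP) => h.
  by move=> i j iS jS; have := h (i, j); rewrite /= iS jS genmxE => /(_ isT).
by move=> [i j] /= /andP[iS jS]; rewrite genmxE h.
Qed.

Lemma hull_sub_gen S x i : i \in S -> hull S x -> (x - a i <= gen_span S)%MS.
Proof.
move=> iS [w [_ wS w1 ->]].
rewrite -[a i]scale1r -w1 scaler_suml -sumrB summx_sub // => j _.
rewrite -scalerBr; have [jS|/wS->] := boolP (j \in S).
  by rewrite scalemx_sub // gen_sub.
by rewrite scale0r sub0mx.
Qed.

Lemma hull_diff S x y : hull S x -> hull S y -> (x - y <= gen_span S)%MS.
Proof.
move=> Sx Sy; have [i iS] := hull_neq0 Sx.
rewrite -[x](subrK (a i)) -addrA addmx_sub ?hull_sub_gen //.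
by rewrite -opprB eqmx_opp hull_sub_gen.
Qed.

Lemma affine_dim_rank S d : affine_dim (hull S) d -> d = gen_rank S.
Proof.
move=> [x0 [W [Sx0 /eqP rW FW subW]]].
apply/eqP; rewrite -[d in d == _]rW eqn_leq !mxrankS //; last first.
  apply/row_subP => i; rewrite -[row i W](addrK x0) [row i W + _]addrC.
  exact: hull_diff.
apply/gen_spanP => i j iS jS.
rewrite -[a i](subrK x0) -addrA addmx_sub ?subW //; first exact: hull_gen.
by rewrite -opprB eqmx_opp subW //; exact: hull_gen.
Qed.

Lemma affine_dim_hull S i : i \in S -> affine_dim (hull S) (gen_rank S).
Proof.
(* Generators outside [S] get the zero row, which leaves the row space unchanged; a maximal free
   family of rows then supplies the basis. *)
move=> iS; pose A : 'M[R]_(k,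
  n) := \matrix_j (if j \in S then a j - a i else 0).
have rA j : row j A = if j \in S then a j - a i else 0 by rewrite rowK.
have -> : gen_rank S = \rank A.
  apply/eqP; rewrite eqn_leq !mxrankS //.
    by apply/row_subP => j; rewrite rA; case: ifP => jS;
      rewrite ?sub0mx ?gen_sub.
  have aA j : j \in S -> (a j - a i <= A)%MS.
    by move=> jS; have := row_sub j A; rewrite rA jS.
  apply/gen_spanP => j l jS lS.
  rewrite -[a j](subrK (a i)) -addrA addmx_sub ?aA //.
  by rewrite -opprB eqmx_opp aA.
exists (a i), (rowsub (maxrankfun A) A); split; first exact: hull_gen.
- exact: maxrowsub_free.
- move=> j; have -> : row j (rowsub (maxrankfun A) A) = row (maxrankfun A j) A.
    by apply/rowP => l; rewrite !mxE.
  rewrite rA; case: ifP => jS; last by rewrite addr0; exact: hull_gen.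
  by rewrite addrC subrK; exact: hull_gen.
- move=> x Sx; rewrite eq_maxrowsub.
  apply: (submx_trans (hull_sub_gen iS Sx)); apply/gen_spanP => j l jS lS.
  have aA m : m \in S -> (a m - a i <= A)%MS.
    by move=> mS; have := row_sub m A; rewrite rA mS.
  rewrite -[a j](subrK (a i)) -addrA addmx_sub ?aA //.
  by rewrite -opprB eqmx_opp aA.
Qed.

(** The signs of differences of generators record which generators are maximal; this ties the normal
    fan to the arrangement. *)
Lemma argmax_sgn S u i j : i \in argmax S u -> j \in S ->
  sgn3 (dot u (a i - a j)) = (j \notin argmax S u, false).
Proof.
move=> /argmaxP[iS imax] jS;
  rewrite /sgn3 dotBr subr_gt0 subr_lt0 !ltNge imax //.
congr (~~ _, _); apply/idP/argmaxP => [ij|[_]]; last exact.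
by split=> // l lS; rewrite (le_trans (imax l lS)).
Qed.

Lemma dot_gen_argmax S u x : (x <= gen_span (argmax S u))%MS -> dot u x = 0.
Proof.
move=> xM; apply/eqP; rewrite -dot_kermx (submx_trans xM) //.
apply/gen_spanP => i j iM jM; rewrite dot_kermx.
have /argmaxP[jS _] := jM.
by have := argmax_sgn iM jS; rewrite jM /sgn3 => -[p n0];
  rewrite eq_le !leNgt p n0.
Qed.

Lemma gen_span_sub S T : S \subset T -> (gen_span S <= gen_span T)%MS.
Proof.
by move=> /fintype.subsetP ST; apply/gen_spanP => i j /ST iT /ST jT;
  rewrite gen_sub.
Qed.

(** [u] vanishes on the span of the face, which by rank is the whole span, so every generator of [S]
    attains the maximum. *)
Lemma argmax_full S u i : i \in S -> (gen_rank S <= gen_rank (argmax S u))%N ->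
  argmax S u = S.
Proof.
move=> iS le; apply/eqP; rewrite finset.eqEsubset argmax_sub /=.
have [m mM] := argmax_ex u iS; have /argmaxP[mS mmax] := mM.
have sub := gen_span_sub (argmax_sub S u).
have /eqP : gen_rank (argmax S u) = gen_rank S by apply/eqP;
  rewrite eqn_leq le mxrankS.
rewrite (mxrank_leqif_sup sub) => SM; apply/fintype.subsetP => j jS.
apply/argmaxP; split=> // l lS; rewrite (le_trans (mmax l lS)) //.
rewrite -subr_le0 -dotBr le_eqVlt (@dot_gen_argmax S u) ?eqxx //.
by rewrite (submx_trans _ SM) // gen_sub.
Qed.

End Hull.

(** * The normal fan *)

Section Fan.
Variables (R : realType) (n k : nat) (a : 'I_k -> 'rV[R]_n).
Implicit Types (u w p x y z : 'rV[R]_n) (S T : {set 'I_k}).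

Definition diffs (ij : 'I_k * 'I_k) : 'rV[R]_n := a ij.1 - a ij.2.

(** Comparisons of the maximal generators with all of [S]; their signs cut out the relative interior
    of a normal cone. *)
Definition max_forms S p : {set 'I_k * 'I_k} :=
  [set ij | (ij.1 \in argmax a S p) && (ij.2 \in S)]%SET.

Lemma agree_max_forms S p u :
  agree diffs (max_forms S p) p u = (argmax a S u == argmax a S p).
Proof.
apply/agreeP/eqP => [pu|up [i j]]; last first.
  rewrite inE /= => /andP[iM jS]; have iMu := iM; rewrite -up in iMu.
  by rewrite (argmax_sgn iM jS) (argmax_sgn iMu jS) up.
have sgn i j : i \in argmax a S p -> j \in S ->
    sgn3 (dot u (a i - a j)) = (j \notin argmax a S p, false).
  by move=> iM jS; rewrite -(argmax_sgn iM jS) (pu (i, j)) // inE /= iM.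
have sub i : i \in argmax a S p -> i \in argmax a S u.
  move=> iM; have /argmaxP[iS _] := iM; apply/argmaxP; split=> // j jS.
  by have [_] := sgn i j iM jS; rewrite -subr_ge0 -dotBr leNgt => ->.
apply/setP => j; apply/idP/idP => [jM|]; last exact: sub.
have /argmaxP[jS _] := jM; have [i iM] := argmax_ex a p jS.
by have := sgn i j iM jS;
  rewrite (argmax_sgn (sub i iM) jS) jM => -[/esym/negbFE].
Qed.

Lemma agree_max_formsN S p u :
  agree diffs (max_forms S (- p)) p u = (argmax a S (- u) == argmax a S (- p)).
Proof.
rewrite -agree_max_forms.
have sgnN (c d : R) : (sgn3 (- c) = sgn3 (- d)) <-> (sgn3 c = sgn3 d).
  by rewrite /sgn3 !oppr_lt0 !oppr_gt0; split=> -[-> ->].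
by apply/agreeP/agreeP => pu j /pu; rewrite !dotNl sgnN.
Qed.

(** A comparison that vanishes at [p] is between two maximal generators, so the codimension of the
    normal cone is the dimension of the face. *)
Lemma form_span_max S p :
  (form_span diffs (max_forms S p) p :=: gen_span a (argmax a S p))%MS.
Proof.
apply/eqmxP/andP; split.
  apply/form_spanP => -[i j]; rewrite inE /= => /andP[iM jS] p0.
  apply: gen_sub => //; apply: contraT => jM.
  by have := argmax_sgn iM jS; rewrite p0 jM /sgn3 ltxx.
apply/gen_spanP => i j iM jM; have /argmaxP[jS _] := jM.
apply: (@form_sub _ _ _ diffs _ _ (i, j)); first by rewrite inE iM.
by apply: (@dot_gen_argmax _ _ _ a S); apply: gen_sub.
Qed.

Lemma chi_fan S p :
  chi diffs (fun u => (argmax a S u == argmax a S p)%:R) =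
    (-1) ^+ gen_rank a (argmax a S p).
Proof.
rewrite /gen_rank -form_span_max -/(form_rank _ _ _) -chi_agree.
by apply: eq_chi => u; rewrite agree_max_forms.
Qed.

(** Fixing the faces at [p] and at [- p] is again a single sign pattern, whose vanishing forms span
    the sum of the two direction spaces. *)
Lemma chi_fan_pair S p :
  chi diffs (fun u => ((argmax a S u == argmax a S p)
                       && (argmax a S (- u) == argmax a S (- p)))%:R) =
    (-1) ^+ \rank (gen_span a (argmax a S p) +
                   gen_span a (argmax a S (- p)))%MS.
Proof.
have eW : (gen_span a (argmax a S p) + gen_span a (argmax a S (- p)) :=:
    form_span diffs (max_forms S p :|: max_forms S (- p)) p)%MS.
  apply: eqmx_trans (eqmx_sym (form_spanU _ _ _ _)); apply: adds_eqmx.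
    exact/eqmx_sym/form_span_max.
  apply: eqmx_trans (eqmx_sym (form_span_max _ _)) _.
  suff -> : form_span diffs (max_forms S (- p)) (- p) =
            form_span diffs (max_forms S (- p)) p by [].
  by apply: eq_bigl => j; rewrite dotNl oppr_eq0.
rewrite eW -/(form_rank _ _ _) -chi_agree.
by apply: eq_chi => u; rewrite agreeU agree_max_forms agree_max_formsN.
Qed.

Definition polar_cone S F G : set 'rV[R]_n :=
  [set u | F `<=` support_face (hull a S) u /\
           G `<=` support_face (hull a S) (- u)].

(** The cone is closed and polyhedral: the pairs in [C] put each generator of [T] weakly above those
    of [S], and each of [T'] weakly below. *)
Lemma chi_polar_cone S T T' u : T \subset S -> T' \subset S ->
  polar_cone S (hull a T) (hull a T') u ->
  ~ polar_cone S (hull a T) (hull a T') (- u) ->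
  chi diffs (ind (polar_cone S (hull a T) (hull a T'))) = 0.
Proof.
move=> TS TS'.
pose C := [set ij : 'I_k * 'I_k | (ij.1 \in T) && (ij.2 \in S)
                               || (ij.1 \in S) && (ij.2 \in T')]%SET.
suff -> : polar_cone S (hull a T) (hull a T') = closed_cone diffs C.
  exact: chi_closed_cone.
have subP (Q : {set 'I_k}) v : Q \subset S ->
  hull a Q `<=` support_face (hull a S) v <->
    forall i j, i \in Q -> j \in S -> 0 <= dot v (a i - a j).
  move=> QS; have /fintype.subsetP QS' := QS; rewrite -sub_argmax //; split.
    move=> /fintype.subsetP QM i j /QM/argmaxP[_ imax] jS.
    by rewrite dotBr subr_ge0 imax.
  move=> QM; apply/fintype.subsetP => i iQ; apply/argmaxP.
  by split=> [|j jS]; [exact: QS'|rewrite -subr_ge0 -dotBr QM].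
apply/seteqP; split=> v; rewrite /polar_cone /= !subP //.
  move=> [vT vT'] [i j]; rewrite inE /= => /orP[]/andP[iT jT]; first exact: vT.
  by rewrite /diffs /= -opprB dotNr -dotNl vT'.
move=> vC; split=> i j iT jS; first by apply: (vC (i, j)); rewrite inE /= iT jS.
by rewrite dotNl -dotNr opprB; apply: (vC (j, i)); rewrite inE /= iT jS orbT.
Qed.

End Fan.

(** * Faces of dimension zero and one *)

Section SmallFaces.
Variables (R : realType) (n k : nat) (a : 'I_k -> 'rV[R]_n).
Implicit Types (u w p x y z : 'rV[R]_n) (S T : {set 'I_k}) (F G : set 'rV[R]_n).

Lemma affine_dim0 F : affine_dim F 0 -> exists x, F = [set x].
Proof.
move=> [x [W [Fx _ _ FW]]]; exists x; apply/seteqP; split=> [y Fy|y ->//].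
by have /submxP[D] := FW y Fy; rewrite (flatmx0 W) mulmx0 => /eqP;
  rewrite subr_eq0 => /eqP.
Qed.

Lemma affine_dim_set1 x d : affine_dim [set x] d -> d = 0%N.
Proof.
move=> [y [W [-> /eqP rW Wx _]]]; apply/eqP; rewrite -rW mxrank_eq0.
apply/eqP/row_matrixP => i; have := Wx i; rewrite row0 => /= /eqP.
by rewrite -subr_eq0 addrAC subrr add0r => /eqP.
Qed.

Lemma faces_set1 x F : faces [set x] F <-> F = [set x].
Proof.
split=> [[[y Fy] [u FE]]|->].
  rewrite FE in Fy *; apply/seteqP; split=> z; first by case.
  by move=> ->; split=> // t ->.
split; first by exists x.
by exists 0; apply/seteqP; split=> [z ->|z []//]; split=> // t ->.
Qed.

Lemma vertices_set1 x : vertices [set x] = [set x].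
Proof.
apply/seteqP; split=> y.
  by move=> /faces_set1 xy; have : [set y] y by []; rewrite xy.
by move=> ->; apply/faces_set1.
Qed.

Lemma edges_set1 x : edges [set x] = set0.
Proof. by apply/seteqP; split=> // E [/faces_set1 -> /affine_dim_set1]. Qed.

Lemma face_dim S F : faces (hull a S) F -> exists d, affine_dim F d.
Proof.
move=> /facesP[u [-> [i iM]]]; exists (gen_rank a (argmax a S u)).
exact: affine_dim_hull iM.
Qed.

Lemma affine_dim_uniq S F d d' : faces (hull a S) F ->
  affine_dim F d -> affine_dim F d' -> d = d'.
Proof.
by move=> /facesP[u [-> _]] /affine_dim_rank-> /affine_dim_rank->.
Qed.

Lemma face_dim_le S F d d' : faces (hull a S) F -> affine_dim F d ->
  affine_dim (hull a S) d' -> (d <= d')%N.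
Proof.
move=> /facesP[u [-> _]] /affine_dim_rank-> /affine_dim_rank->.
exact/mxrankS/gen_span_sub/argmax_sub.
Qed.

Lemma face_full S F d : faces (hull a S) F -> affine_dim F d ->
  affine_dim (hull a S) d -> F = hull a S.
Proof.
move=> /facesP[u [-> [i iM]]] /affine_dim_rank dM /affine_dim_rank dS.
have /argmaxP[iS _] := iM.
by rewrite (argmax_full iS) // -dM -dS.
Qed.

Lemma face_self S F : faces (hull a S) F -> faces (hull a S) (hull a S).
Proof.
move=> /facesP[u [_ [i /argmaxP[iS _]]]]; split; first by exists (a i);
  apply: hull_gen.
exists 0; apply/seteqP; split=> [x Sx|x []//].
by split=> // y _; rewrite !dot0l.
Qed.

Lemma edges_segment S : affine_dim (hull a S) 1 ->
  edges (hull a S) = [set hull a S].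
Proof.
move=> dS; have [x0 [_ [Sx0 _ _ _]]] := dS.
have [i iS] := hull_neq0 Sx0.
apply/seteqP; split=> E.
  by move=> [ES dE]; exact: face_full ES dE dS.
move=> ->; split=> //; split; first by exists x0.
exists 0; apply/seteqP; split=> [x Sx|x []//].
by split=> // y _; rewrite !dot0l.
Qed.

(** The ends are generators maximizing the direction [w] of the line and [- w]; for any functional
    [u] the sign of [dot u w] decides which end is a maximum. The last clause serves
    [midpoint_sub]. *)
Lemma segmentP S : affine_dim (hull a S) 1 -> exists x y,
  [/\ x <> y, vertices (hull a S) = [set x; y], hull a S x, hull a S y &
    forall u, dot u x = dot u y -> forall z, hull a S z -> dot u z = dot u x].
Proof.
move=> dS; have [x0 [W [Sx0 /eqP rW Wx0 WS]]] := dS.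
pose w := row 0 W.
have WE : W = w by apply/rowP => j; rewrite mxE.
have w0 : w != 0 by apply: contra_eq_neq rW; rewrite -WE => ->; rewrite mxrank0.
have w_gt0 := dotuu_gt0 w0.
have line z z' : hull a S z -> hull a S z' -> exists t, z - z' = t *: w.
  move=> Sz Sz'; apply/sub_rVP; rewrite -WE.
  rewrite -[z](subrK x0) -addrA addmx_sub ?WS //.
  by rewrite -opprB eqmx_opp WS.
have [i iS] := hull_neq0 Sx0.
have [ix /argmaxP[xS xmax]] := argmax_ex a w iS.
have [iy /argmaxP[yS ymax]] := argmax_ex a (- w) iS.
set x := a ix in xmax; set y := a iy in ymax.
have Sx : hull a S x := hull_gen a xS; have Sy : hull a S y := hull_gen a yS.
have below_x z : hull a S z -> exists2 t, 0 <= t & x - z = t *: w.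
  move=> Sz; have [t xz] := line _ _ Sx Sz; exists t => //.
  have := hull_le xmax Sz; rewrite -subr_ge0 -dotBr xz dotZr.
  by rewrite pmulr_lge0.
have above_y z : hull a S z -> exists2 t, 0 <= t & y - z = - t *: w.
  move=> Sz; have [t yz] := line _ _ Sy Sz; exists (- t); last by rewrite opprK.
  have := hull_le ymax Sz; rewrite -subr_ge0 -dotBr yz dotZr dotNl.
  by rewrite mulrN -mulNr pmulr_lge0.
have extreme u z : [set z] = support_face (hull a S) u -> z = x \/ z = y.
  move=> zu; have [Sz zmax] : support_face (hull a S) u z by rewrite -zu.
  have [uw|uw] := leP 0 (dot u w).
    left; suff : [set z] x by move=> ->.
    rewrite zu; split=> // v Sv; rewrite -subr_ge0 -dotBr.
    by have [t t0 ->] := below_x v Sv; rewrite dotZr mulr_ge0.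
  right; suff : [set z] y by move=> ->.
  rewrite zu; split=> // v Sv; rewrite -subr_ge0 -dotBr.
  by have [t t0 ->] := above_y v Sv;
    rewrite dotZr mulNr -mulrN mulr_ge0 // oppr_ge0 ltW.
have eq_w z z' : hull a S z -> hull a S z' ->
  dot w z' <= dot w z <= dot w z' -> z = z'.
  move=> Sz Sz' /le_anti/eqP; have [t zz'] := line _ _ Sz Sz'.
  rewrite -subr_eq0 -opprB oppr_eq0 -dotBr zz' dotZr mulf_eq0 (gt_eqF w_gt0)
    orbF.
  by move/eqP=> t0; apply/eqP; rewrite -subr_eq0 zz' t0 scale0r.
have xy : x <> y.
  move=> xy; have := hull_le xmax (Wx0 0); rewrite xy.
  have := hull_le ymax Sx0; rewrite !dotNl lerN2 => le1 le2.
  have := le_trans le2 le1; rewrite dotDr gerDl leNgt.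
  by rewrite w_gt0.
have vx : vertices (hull a S) x.
  split; first by exists x.
  exists w; apply/seteqP; split=> [z ->|z [Sz zmax]].
    by split=> // v; exact: hull_le.
  by apply: eq_w => //; rewrite zmax // (hull_le xmax Sz).
have vy : vertices (hull a S) y.
  split; first by exists y.
  exists (- w); apply/seteqP; split=> [z ->|z [Sz zmax]].
    by split=> // v; exact: hull_le.
  apply: eq_w => //.
  by have := zmax _ Sy; have := hull_le ymax Sz; rewrite !dotNl !lerN2 => -> ->.
exists x, y; split=> //.
  apply/seteqP; split=> [z [_ [u zu]]|z [->|->]] //; exact: extreme zu.
move=> u uxy z Sz; have [s xy'] := line _ _ Sx Sy.
have uw : dot u w = 0.
  have : dot u (x - y) == 0 by rewrite dotBr uxy subrr.
  rewrite xy' dotZr mulf_eq0 => /orP[/eqP s0|/eqP//].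
  by case: xy; apply/eqP; rewrite -subr_eq0 xy' s0 scale0r.
have [t _ xz] := below_x z Sz.
by apply/eqP; rewrite eq_sym -subr_eq0 -dotBr xz dotZr uw mulr0.
Qed.

End SmallFaces.

(** * Counting vertices and edges *)

Section Counting.
Variable T : choiceType.
Implicit Types (A D : set T) (x y : T).

Lemma eq_sum_fset A (f g : T -> int) : finite_set A ->
  (forall x, A x -> f x = g x) ->
  \sum_(x <- fset_set A) f x = \sum_(x <- fset_set A) g x.
Proof. by move=> finA fg; apply: eq_big_seq => x;
  rewrite in_fset_set // => /set_mem/fg. Qed.

Lemma sum_setI A D (f : T -> int) : finite_set A ->
  \sum_(x \in A `&` D) f x = \sum_(x <- fset_set A) ind D x * f x.
Proof.
move=> finA; rewrite fsbig_mkcondr fsbig_finite //; apply: eq_bigr => x _.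
rewrite /ind; case: ifPn => [/set_mem Dx|/negP Dx];
  first by rewrite asboolT ?mul1r.
by rewrite asboolF ?mul0r // => /mem_set.
Qed.

Lemma ncardE A : (ncard A)%:Z = \sum_(x <- fset_set A) 1.
Proof. by rewrite /ncard big_const_seq count_predT iter_addr_0 natz. Qed.

Lemma ncard_setI A D : finite_set A ->
  (ncard (A `&` D))%:Z = \sum_(x <- fset_set A) ind D x.
Proof.
move=> finA; rewrite ncardE -fsbig_finite ?sum_setI //;
  last exact: finite_setIl.
by apply: eq_bigr => x _; rewrite mulr1.
Qed.

Lemma ncard1 x : ncard [set x] = 1%N.
Proof. by rewrite /ncard fset_set1 cardfs1. Qed.

Lemma ncard2 x y : x <> y -> ncard [set x; y] = 2%N.
Proof.
move=> xy; rewrite /ncard fset_setU1 // fset_set1 cardfs2.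
by have /eqP/negPf-> := xy.
Qed.

Lemma ind_eq x y : ind [set z | x = z] y = (x == y)%:R.
Proof. by rewrite /ind; congr (_%:R : int); congr nat_of_bool;
  apply/asboolP/eqP. Qed.

Lemma sum_pred1 A x0 : finite_set A ->
  \sum_(x <- fset_set A) ind [set x | x0 = x] x = ind A x0.
Proof.
move=> finA; rewrite -ncard_setI // /ind; case: asboolP => Ax0.
  suff -> : A `&` [set x | x0 = x] = [set x0] by rewrite ncard1.
  by apply/seteqP; split=> x; [case=> _ /= ->|move=> ->].
suff -> : A `&` [set x | x0 = x] = set0 by rewrite /ncard fset_set0 cardfs0.
by apply/seteqP; split=> // x [Ax /= xx0]; rewrite -xx0 in Ax.
Qed.

Lemma set2_eq x y x' y' : [set x; y] = [set x'; y'] ->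
  (x = x' /\ y = y') \/ (x = y' /\ y = x').
Proof.
move=> e.
have [xx'|xy'] : [set x'; y'] x by rewrite -e; left.
  have [y1|y1] : [set x'; y'] y by rewrite -e; right.
    have [z1|z1] : [set x; y] y' by rewrite e; right.
      by left; split=> //; rewrite z1 xx' y1.
    by left.
  by left.
have [y1|y1] : [set x'; y'] y by rewrite -e; right.
  by right.
have [z1|z1] : [set x; y] x' by rewrite e; left.
  by left; split.
by right; split=> //; rewrite z1.
Qed.

End Counting.

(** Double counting: a third summation over the unordered pairs [S] is inserted, and each [S] arises
    from exactly two ordered pairs. *)
Lemma sum_sym_pairs (T : choiceType) (A : set T) (r : T -> T -> Prop) :
  finite_set A -> (forall x y, r x y -> r y x) ->
  \sum_(x <- fset_set A) \sum_(y <- fset_set A) ind [set x | x <> y /\ r x y] x =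
  2 * (ncard [set S | exists x y,
    [/\ A x, A y, x <> y, r x y & S = [set x; y]]])%:Z.
Proof.
move=> finA rC; set U := [set S | _].
have finU : finite_set U.
  apply: sub_finite_set (finite_image2 (fun x y => [set x; y]) finA finA) => S.
  by move=> [x [y [Ax Ay _ _ ->]]]; exists x => //; exists y.
rewrite ncardE // mulr_sumr.
transitivity (\sum_(x <- fset_set A) \sum_(y <- fset_set A)
    \sum_(S <- fset_set U)
    ind [set S | [set x; y] = S] S).
  apply: eq_sum_fset => // x Ax; apply: eq_sum_fset => // y Ay.
  rewrite sum_pred1 // /ind; congr (_%:R : int); congr nat_of_bool.
  apply/asboolP/asboolP => [[xy rxy]|[x' [y' [_ _ xy' rxy' /set2_eq]]]].
    by exists x, y.
  by move=> [[-> ->]//|[-> ->]]; split; [exact/nesym|exact: rC].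
under eq_bigr do rewrite exchange_big.
rewrite exchange_big; apply: eq_sum_fset => // S [x0 [y0 [Ax0 Ay0 xy0 _ ->]]].
transitivity (\sum_(x <- fset_set A) \sum_(y <- fset_set A)
   (ind [set x | x0 = x] x * ind [set y | y0 = y] y
    + ind [set x | y0 = x] x * ind [set y | x0 = y] y)).
  apply: eq_bigr => x _; apply: eq_bigr => y _; rewrite !ind_eq.
  have -> : ([set x; y] == [set x0; y0]) =
      (x0 == x) && (y0 == y) || (y0 == x) && (x0 == y).
    apply/eqP/orP => [/set2_eq[[-> ->]|[-> ->]]|[]/andP[/eqP-> /eqP->]//=].
    + by left; rewrite !eqxx.
    + by right; rewrite !eqxx.
    + by rewrite setUC.
  have [<-|_] := eqVneq x0 x; last by rewrite mul0r add0r -natrM mulnb.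
  by rewrite (negPf (introN eqP (nesym xy0))) mul0r addr0 orbF mul1r.
under eq_bigr do rewrite big_split /= -!mulr_sumr !sum_pred1 //.
rewrite big_split /= -!mulr_suml !sum_pred1 //.
by rewrite /ind !asboolT.
Qed.

(** * Face counts, and polygons having as many vertices as edges *)

Section Polyhedra.
Variables (R : realType) (k : nat) (a : 'I_k -> 'rV[R]_3).
Implicit Types (u w p x y z : 'rV[R]_3) (S T : {set 'I_k})
  (F G E : set 'rV[R]_3).

Lemma finite_faces S : finite_set (faces (hull a S)).
Proof.
apply: sub_finite_set (finite_image (hull a) (finite_finset (X := setT))) => F.
by move=> /facesP[u [-> _]]; exists (argmax a S u).
Qed.

Lemma finite_vertices S : finite_set (vertices (hull a S)).
Proof.
apply: sub_finite_set (finite_image a (finite_finset (X := setT))) => x.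
move=> /facesP[u [xE [i iM]]]; exists i => //.
by have : [set x] (a i) by rewrite xE; exact: hull_gen.
Qed.

Lemma finite_edges S : finite_set (edges (hull a S)).
Proof. by apply: sub_finite_set (finite_faces S) => F []. Qed.

(** By [faces_face], the vertices of a support face are the vertices of the hull lying in it, which
    makes the count a sum of incidence indicators. *)
Lemma nvert_support S u : (nvert (support_face (hull a S) u))%:Z =
  \sum_(x <- fset_set (vertices (hull a S)))
    ind [set x | [set x] `<=` support_face (hull a S) u] x.
Proof.
rewrite -ncard_setI; last exact: finite_vertices.
congr ((ncard _)%:Z); apply/seteqP; split=> x.
  by move=> /faces_face[]; split.
by move=> [vx xF]; apply/faces_face.
Qed.

Lemma nedge_support S u : (nedge (support_face (hull a S) u))%:Z =
  \sum_(E <- fset_set (edges (hull a S)))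
    ind [set E | E `<=` support_face (hull a S) u] E.
Proof.
rewrite -ncard_setI; last exact: finite_edges.
congr ((ncard _)%:Z); apply/seteqP; split=> E.
  by move=> [/faces_face[EP sub] dE].
by move=> [[EP dE] sub]; split=> //; apply/faces_face.
Qed.

Lemma nvert_dim0 F : affine_dim F 0 -> nvert F = 1%N.
Proof. by move=> /affine_dim0[x ->]; rewrite /nvert vertices_set1 ncard1. Qed.

Lemma nedge_dim0 F : affine_dim F 0 -> nedge F = 0%N.
Proof.
by move=> /affine_dim0[x ->];
  rewrite /nedge edges_set1 /ncard fset_set0 cardfs0.
Qed.

Lemma nvert_dim1 S : affine_dim (hull a S) 1 -> nvert (hull a S) = 2%N.
Proof. by move=> /segmentP[x [y [xy E _ _ _]]]; rewrite /nvert E ncard2. Qed.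

Lemma nedge_dim1 S : affine_dim (hull a S) 1 -> nedge (hull a S) = 1%N.
Proof. by move=> /edges_segment E; rewrite /nedge E ncard1. Qed.

Lemma support_face_face S u x : hull a S x ->
  faces (hull a S) (support_face (hull a S) u).
Proof.
move=> /hull_neq0[i /(argmax_ex a u) [j jM]].
by apply/facesP; exists u; rewrite support_hull; split=> //; exists j.
Qed.

Lemma chi_face S G d : faces (hull a S) G -> affine_dim G d ->
  chi (diffs a) (fun u => ind [set F | support_face (hull a S) u = F] G) = (-1)
    ^+ d.
Proof.
move=> /facesP[p [-> _]] /affine_dim_rank ->; rewrite -chi_fan.
apply: eq_chi => u; rewrite /ind; congr (_%:R : int); congr nat_of_bool.
rewrite support_hull; apply/asboolP/eqP => /=; last by move=> ->.
by rewrite hull_inj_argmax.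
Qed.

Lemma support_faceN_const P u x : support_face P u x ->
  support_face P (- u) x ->
  forall y, P y -> dot u y = dot u x.
Proof.
move=> [_ xmax] [_ xmin] y Py; apply/eqP; rewrite eq_le xmax //=.
by have := xmin y Py; rewrite !dotNl lerN2.
Qed.

Lemma hull_set0 : hull a finset.set0 = set0.
Proof. by apply/seteqP; split=> // x /hull_neq0[i]; rewrite inE. Qed.

(** The vertex count of the support face has characteristic 0, since the closed normal cones of
    vertices are not subspaces. Grouped by faces instead, each vertex gives 1, each edge -2 and the
    polygon its vertex number, whence 2 v - 2 e = 0. *)
Lemma polygon_nvert S : affine_dim (hull a S) 2 ->
  nvert (hull a S) = nedge (hull a S).
Proof.
move=> dS; have [x0 [_ [Sx0 _ _ _]]] := dS.
set Q := hull a S in dS Sx0 *; set chi := chi (diffs a).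
have QQ : faces Q Q := face_self (support_face_face 0 Sx0).
have fV := finite_vertices S; have fE := finite_edges S.
have sumV : chi (fun u => (nvert (support_face Q u))%:Z) = 0.
  rewrite /chi (eq_chi _ (nvert_support S)) chi_sum big1_seq // => x /andP[_];
    rewrite in_fset_set // => /set_mem vx.
  have [_ [p xp]] := vx;
    have [T TS xT] : exists2 T : {set 'I_k}, T \subset S & [set x] = hull a T.
    by exists (argmax a S p); rewrite ?argmax_sub // xp support_hull.
  (* With an empty second face, the polar cone is the normal cone of [x]. *)
  rewrite -[RHS](@chi_polar_cone _ _ _ a S T finset.set0 p) ?finset.sub0set //.
  - apply: eq_chi => u; rewrite /ind; congr (_%:R : int); congr nat_of_bool.
    by apply/asboolP/asboolP; rewrite /polar_cone /= -xT hull_set0 // => -[].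
  - by split; rewrite -?xT ?xp // hull_set0.
  - rewrite /polar_cone /= -xT => -[xNp _].
    have xN : support_face Q (- p) x by apply: xNp.
    have xP : support_face Q p x by rewrite -xp.
    (* A functional maximal at [x] in both directions is constant on [Q], so its support face would
       be all of [Q]. *)
    have Qx : Q = [set x].
      rewrite xp; apply/seteqP; split=> [y Qy|y []//]; split=> // z Qz.
      by rewrite (support_faceN_const xP xN Qz) (support_faceN_const xP xN Qy).
    by move: dS; rewrite Qx => /affine_dim_set1.
(* Exactly one of the three terms is active, according to the dimension of the support face. *)
have faceE u : (nvert (support_face Q u))%:Z =
    \sum_(x <- fset_set (vertices Q)) ind [set F | support_face Q u = F] [set x]
    + 2 * (\sum_(E <- fset_set (edges Q)) ind [set F | support_face Q u = F] E)
    + (nvert Q)%:Z * ind [set F | support_face Q u = F] Q.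
  have uF := support_face_face u Sx0; have [d du] := face_dim uF.
  have := face_dim_le uF du dS.
  rewrite sum_pred1 // ind_eq.
  case: d du => [|[|[|//]]] du _.
  - rewrite nvert_dim0 //; have [x ux] := affine_dim0 du.
    have vx : vertices Q x by rewrite /vertices /= -ux.
    under eq_bigr => y _.
      have -> : ind [set F | support_face Q u = F] [set y] =
          ind [set y | x = y] y.
        rewrite !ind_eq ux; congr (nat_of_bool _)%:R.
        by apply/eqP/eqP => [xy|->//]; have : [set y] x by rewrite -xy.
      over.
    rewrite sum_pred1 // /ind asboolT // asboolF => [|[_ dE]]; last first.
      by have := affine_dim_uniq uF du dE.
    rewrite [_ == Q]negbTE ?mulr0 ?addr0 //; apply/eqP => uQ.
    by rewrite -uQ in dS; have := affine_dim_uniq uF du dS.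
  - rewrite (_ : nvert _ = 2%N); last first.
      by move: du; rewrite /Q support_hull; exact: nvert_dim1.
    rewrite big1 => [|x _]; last first.
      rewrite ind_eq; case: eqP => // ux.
      by move: du; rewrite ux => /affine_dim_set1.
    rewrite /ind asboolT // [_ == Q]negbTE ?mulr0 ?addr0 //; apply/eqP => uQ.
    by rewrite -uQ in dS; have := affine_dim_uniq uF du dS.
  - have uQ : support_face Q u = Q := face_full uF du dS.
    rewrite big1 => [|x _]; last first.
      rewrite ind_eq; case: eqP => // ux.
      by move: du; rewrite ux => /affine_dim_set1.
    rewrite /ind asboolF ?uQ ?eqxx ?mulr1 ?mulr0 // => -[_ dE].
    by have := affine_dim_uniq QQ dS dE.
move: sumV; rewrite /chi (eq_chi _ faceE) !chiD !chiZ !chi_sum (chi_face QQ dS)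
  sqrrN expr1n.
rewrite (eq_sum_fset (g := fun=> 1)) // => [|x vx]; last first.
  by rewrite (@chi_face S [set x] 0) //; exists x, 0; split=> // [|[]//|y ->];
    rewrite ?subrr ?sub0mx // /row_free mxrank0.
rewrite -ncardE // (eq_sum_fset (g := fun=> -1)) // => [|E [QE dE]]; last first.
  by rewrite (chi_face QE dE).
rewrite sumrN -ncardE // -/(nvert Q) -/(nedge Q). lia.
Qed.

End Polyhedra.

(** * Antipodality *)

Section FullPolyhedra.
Variables (R : realType) (k : nat) (a : 'I_k -> 'rV[R]_3).
Implicit Types (u w x y z : 'rV[R]_3) (F G E : set 'rV[R]_3).
Let P := hull a finset.setT.
Hypothesis dP : affine_dim P 3.

Let chi := chi (diffs a).
Let supp u := support_face P u.

(** [u] annihilates the three-dimensional span of differences, hence also itself. *)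
Lemma dot_const_eq0 u x : P x -> (forall y, P y -> dot u y = dot u x) -> u = 0.
Proof.
move=> Px ux; have sub : (gen_span a finset.setT <= kermx u^T)%MS.
  apply/gen_spanP => i j _ _; rewrite dot_kermx dotBr.
  by rewrite !ux ?subrr //; apply: hull_gen; rewrite inE.
have /mxrankS := sub; rewrite -/(gen_rank _ _) -(affine_dim_rank dP) => rk.
have : (u <= kermx u^T)%MS.
  by apply: submx_full; rewrite /row_full eqn_leq rank_leq_col.
by rewrite dot_kermx => /eqP/dotuu_eq0.
Qed.

Lemma support_faceN0 u x : supp u x -> supp (- u) x -> u = 0.
Proof.
move=> ux uNx; apply: (@dot_const_eq0 u x); first by case: ux.
exact: (support_faceN_const ux uNx).
Qed.

Lemma polyhedron_neq0 : exists x, P x.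
Proof. by have [x [_ [Px _ _ _]]] := dP; exists x. Qed.

Lemma supp_neq0 u : exists x, supp u x.
Proof. by have [x Px] := polyhedron_neq0;
  have [] := support_face_face u Px. Qed.

Lemma supp_face u : faces P (supp u).
Proof. by have [x Px] := polyhedron_neq0; exact: support_face_face Px. Qed.

Lemma supp0 : supp 0 = P.
Proof.
by apply/seteqP; split=> [x []//|x Px]; split=> // y _; rewrite !dot0l.
Qed.

Lemma supp_neq u : u <> 0 -> supp u <> supp (- u).
Proof.
move=> u0 uu; have [x ux] := supp_neq0 u; apply: u0.
by apply: (support_faceN0 ux); rewrite -uu.
Qed.

Lemma supp_proper u : u <> 0 -> proper_faces P (supp u).
Proof.
move=> u0; split; first exact: supp_face.
move=> uP; have [x uNx] := supp_neq0 (- u); apply: u0.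
by apply: (support_faceN0 _ uNx); rewrite uP; case: uNx.
Qed.

(** Only the zero direction supports all of [P], so the origin is the normal cone of the face [P],
    of dimension 3. *)
Lemma chi_zero : chi (ind [set 0]) = -1.
Proof.
apply: (@etrans _ _ ((-1) ^+ 3)); last by [].
rewrite [X in _ ^+ X](affine_dim_rank dP);
  have -> : gen_rank a finset.setT = gen_rank a (argmax a finset.setT 0).
  congr (gen_rank a); apply/setP => i; rewrite inE; apply/esym/argmaxP.
  by split=> [|j _]; rewrite ?inE // !dot0l.
rewrite -chi_fan; apply: eq_chi => u; rewrite /ind; congr (_%:R : int).
congr nat_of_bool; apply/asboolP/eqP => [->//|/hull_inj_argmax].
rewrite -!support_hull -/P -/(supp u) -/(supp 0) supp0 => uP.
have [x uNx] := supp_neq0 (- u); apply: (support_faceN0 _ uNx).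
by rewrite uP; case: uNx.
Qed.

Definition nz u : int := ind [set u | u <> 0] u.

Lemma nzE u : nz u = 1 - ind [set 0] u.
Proof. by rewrite /nz /ind /= asbool_neg; case: asbool. Qed.

(** The whole space is the cone without constraints, of characteristic 1, and removing the origin
    subtracts -1. *)
Lemma chi_nz : chi nz = 2.
Proof.
rewrite /chi (eq_chi _ nzE) chiB -/chi chi_zero.
have -> : chi (fun=> 1) = 1; last by [].
transitivity ((-1) ^+ form_rank (diffs a) finset.set0 0 : int).
  rewrite -chi_agree; apply: eq_chi => u.
  suff -> : agree (diffs a) finset.set0 0 u by [].
  by apply/agreeP => j; rewrite inE.
rewrite /form_rank /form_span big_pred0 ?mxrank0 // => j.
by rewrite inE.
Qed.

Definition antipolar F G : set 'rV[R]_3 :=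
  [set u | u <> 0 /\ polar_cone a finset.setT F G u].

Lemma face_or_set0 F : faces P F \/ F = set0 -> exists T, F = hull a T.
Proof.
move=> [/facesP[u [-> _]]|->]; first by eexists.
by exists finset.set0; rewrite hull_set0.
Qed.

(** If the polar cone contains a nonzero [u], it excludes [- u] and has characteristic 0; removing
    the origin then adds 1. The empty set stands for an absent condition, so that single faces can
    be counted too. *)
Lemma chi_antipolar F G : faces P F \/ F = set0 -> faces P G \/ G = set0 ->
  F `|` G !=set0 ->
  chi (ind (antipolar F G)) = (`[< exists u, antipolar F G u >])%:R.
Proof.
move=> FP GP [x FGx].
have [TF FE] := face_or_set0 FP; have [TG GE] := face_or_set0 GP.
case: asboolP => [[u [u0 uFG]]|none]; last first.
  apply: chi0 => u; rewrite /ind asboolF // => uFG; apply: none.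
  by exists u.
rewrite /chi (eq_chi _ (g := fun u => ind (polar_cone a finset.setT F G) u -
  ind [set 0] u)).
  rewrite chiB -/chi chi_zero /chi FE GE.
  rewrite (@chi_polar_cone _ _ _ a _ TF TG u) ?finset.subsetT // -?FE -?GE //.
  move=> uNFG; apply: u0; case: uFG => Fu GuN; case: uNFG;
    rewrite opprK => FuN Gu.
  by case: FGx => [Fx|Gx]; [apply: (@support_faceN0 u x); [exact: Fu|exact: FuN]
    |apply: (@support_faceN0 u x); [exact: Gu|exact: GuN]].
move=> v; rewrite /ind; case: asboolP => [[v0 vFG]|nv].
  by rewrite asboolT // asboolF ?subr0.
have [->|v0] := pselect (v = 0); last first.
  by rewrite !asboolF ?subr0 // => vFG; apply: nv.
rewrite !asboolT //; split; rewrite ?oppr0 -/(supp 0) supp0.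
  by case: FP => [[_ [w ->]] z []|->].
by case: GP => [[_ [w ->]] z []|->].
Qed.

Lemma antipolar_sym F G : (exists u, antipolar F G u) ->
  exists u, antipolar G F u.
Proof.
move=> [u [u0 [Fu Gu]]]; exists (- u); split; last by split; rewrite ?opprK.
by move=> /eqP; rewrite oppr_eq0 => /eqP.
Qed.

Lemma antipolar_irrefl F : F !=set0 -> ~ exists u, antipolar F F u.
Proof.
move=> [x Fx] [u [u0 [Fu FuN]]]; apply: u0.
by apply: (@support_faceN0 u x); [exact: Fu|exact: FuN].
Qed.

Lemma support_faceZ c u : 0 < c -> supp (c *: u) = supp u.
Proof.
move=> c0; apply/seteqP; split=> x [Px xmax]; split=> // y Py;
by have := xmax y Py; rewrite !dotZl ler_pM2l.
Qed.

Lemma antipodalE x y : antipodal P x y <-> exists u,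
  antipolar [set x] [set y] u.
Proof.
split=> [[Px Py [u u1 uxy]]|[u [/eqP u0 [xu yu]]]].
  exists u; split=> [u0|]; first by
    move: u1; rewrite /unit_sphere /= u0 dot0l => /eqP; rewrite eq_sym oner_eq0.
  split=> z ->; split=> // t Pt; first by have /andP[] := uxy t Pt.
  by rewrite !dotNl lerN2; have /andP[] := uxy t Pt.
have [Px xmax] : supp u x by apply: xu.
have [Py ymin] : supp (- u) y by apply: yu.
have uu := dotuu_gt0 u0; pose c := (Num.sqrt (dot u u))^-1.
have c0 : 0 < c by rewrite invr_gt0 sqrtr_gt0.
split=> //; exists (c *: u).
  rewrite /unit_sphere /= dotZl dotZr mulrA -expr2 exprVn sqr_sqrtr ?ltW //.
  by rewrite mulVf // gt_eqF.
move=> z Pz; rewrite !dotZl !ler_pM2l // xmax // andbT.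
by have := ymin z Pz; rewrite !dotNl lerN2.
Qed.

Lemma ind_polar F G u :
  nz u * ind [set F | F `<=` supp u] F * ind [set F | F `<=` supp (- u)] G =
  ind (antipolar F G) u.
Proof. by rewrite /nz /ind -!natrM !mulnb -!asbool_and;
  congr (nat_of_bool `[< _ >])%:R; rewrite propeqE; split=> [[[]]|[? []]]. Qed.

Lemma ind_sub0 G : ind [set F | F `<=` G] set0 = 1.
Proof. by rewrite /ind asboolT. Qed.

(** * Incidence counts as Euler characteristics *)

Section Incidence.
Variables (T : choiceType) (A : set T) (f : T -> set 'rV[R]_3).
Hypotheses (finA : finite_set A) (fP : forall x : T, A x -> faces P (f x)).

(** The family [f] will be the singletons of vertices, or the edges themselves. *)
Let count u : int := \sum_(x <- fset_set A) ind [set x : T | f x `<=` supp u] x.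

(** Expanding the product gives one polar cone for each ordered pair; the diagonal drops out because
    no nonempty face lies in two opposite support faces of a nonzero direction. *)
Lemma chi_count_pairs : chi (fun u => nz u * (count u * count (- u))) =
  2 * (ncard [set S | exists x y : T, [/\ A x, A y, x <> y,
      exists u, antipolar (f x) (f y) u & S = [set x; y]]])%:Z.
Proof.
rewrite -sum_sym_pairs //; last by move=> x y; exact: antipolar_sym.
rewrite /chi (eq_chi _ (g := fun u => \sum_(x <- fset_set A)
    \sum_(y <- fset_set A) ind (antipolar (f x) (f y)) u)) => [|u].
  rewrite chi_sum; apply: eq_sum_fset => // x Ax; rewrite chi_sum.
  apply: eq_sum_fset => // y Ay; rewrite -/chi.
  rewrite chi_antipolar; [|by left; exact: fP|by left; exact: fP|].
    rewrite /ind; congr (nat_of_bool `[< _ >])%:R; rewrite propeqE.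
    split=> [exy|[]//]; split=> // xy; rewrite xy in exy.
    by apply: (@antipolar_irrefl (f y)) => //; case: (fP Ay).
  by have [[z fz] _] := fP Ax; exists z; left.
rewrite big_distrlr /= mulr_sumr; apply: eq_bigr => x _.
by rewrite mulr_sumr; apply: eq_bigr => y _; rewrite -ind_polar mulrA.
Qed.

(** With an empty second face, each [x] contributes the characteristic of its normal cone without
    the origin, which is 1. *)
Lemma chi_count : (forall x : T, A x -> exists u, u <> 0 /\ f x = supp u) ->
  chi (fun u => nz u * count u) = (ncard A)%:Z.
Proof.
move=> fproper; rewrite ncardE //.
rewrite /chi (eq_chi _ (g := fun u => \sum_(x <- fset_set A)
    ind (antipolar (f x) set0) u)) => [|u].
  rewrite chi_sum; apply: eq_sum_fset => // x Ax; rewrite -/chi.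
  rewrite chi_antipolar; [|by left; exact: fP|by right|].
    rewrite asboolT //; have [u [u0 fu]] := fproper x Ax.
    by exists u; split=> //; split; rewrite ?fu.
  by have [[z fz] _] := fP Ax; exists z; left.
rewrite mulr_sumr; apply: eq_bigr => x _; rewrite -ind_polar ind_sub0.
by rewrite mulr1.
Qed.

Lemma chi_countN : (forall x : T, A x -> exists u, u <> 0 /\ f x = supp u) ->
  chi (fun u => nz u * count (- u)) = (ncard A)%:Z.
Proof.
move=> fproper; rewrite ncardE //.
rewrite /chi (eq_chi _ (g := fun u => \sum_(x <- fset_set A)
    ind (antipolar set0 (f x)) u)) => [|u].
  rewrite chi_sum; apply: eq_sum_fset => // x Ax; rewrite -/chi.
  rewrite chi_antipolar; [|by right|by left; exact: fP|].
    rewrite asboolT //; have [u [u0 fu]] := fproper x Ax.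
    by apply: antipolar_sym; exists u; split=> //; split; rewrite ?fu.
  by have [[z fz] _] := fP Ax; exists z; right.
rewrite mulr_sumr; apply: eq_bigr => x _; rewrite -ind_polar ind_sub0.
by rewrite mulr1.
Qed.

End Incidence.

(** * Antipodal pairs of vertices and of edge midpoints *)

Lemma vertex_supp x : vertices P x -> exists u, u <> 0 /\ [set x] = supp u.
Proof.
move=> [_ [u xu]]; exists u; split=> // u0.
by move: dP; rewrite -supp0 -u0 /supp -xu => /affine_dim_set1.
Qed.

Lemma midpoint_sub E m u : edges P E -> midpoint E m -> supp u m ->
  E `<=` supp u.
Proof.
move=> [EP dE] [x [y [xy vE ->]]] [Pm mmax].
have [S ES] : exists S, E = hull a S by apply: face_or_set0; left.
rewrite ES in dE; have [x' [y' [xy' vE' Ex' Ey' segE]]] := segmentP dE.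
have EsubP z : E z -> P z by case: EP => _ [w ->] [].
have [Ex Ey segxy] : [/\ E x, E y & forall u, dot u x = dot u y ->
    forall z, E z -> dot u z = dot u x].
  rewrite -ES in Ex' Ey' segE vE'; move: vE;
    rewrite vE' => /set2_eq[[<- <-]|[<- <-]].
    by [].
  by split=> // w wxy z Ez; rewrite wxy; apply: segE.
have le_x := mmax x (EsubP x Ex); have le_y := mmax y (EsubP y Ey).
move: le_x le_y; rewrite dotZr dotDr => le_x le_y.
have uxy : dot u x = dot u y by lra.
move=> z Ez; split; first exact: EsubP.
move=> t Pt; have := mmax t Pt; rewrite dotZr dotDr (segxy _ uxy z Ez); lra.
Qed.

Lemma midpoint_ex E : edges P E -> exists m, midpoint E m /\ E m.
Proof.
move=> [EP dE]; have [S ES] : exists S, E = hull a S by apply: face_or_set0;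
  left.
rewrite ES in dE *; have [x [y [xy vE Ex Ey segE]]] := segmentP dE.
by exists (2^-1 *: (x + y)); split; [exists x, y|exact: hull_mid].
Qed.

Lemma antipodal_vertex_pairsE : antipodal_vertex_pairs P =
  [set S | exists x y, [/\ vertices P x, vertices P y, x <> y,
      exists u, antipolar [set x] [set y] u & S = [set x; y]]].
Proof.
apply/seteqP; split=> S [x [y [vx vy xy Axy ->]]]; exists x, y; split=> //.
  exact/antipodalE.
exact/antipodalE.
Qed.

Lemma antipodal_edge_pairsE : antipodal_edge_pairs P =
  [set S | exists E E', [/\ edges P E, edges P E', E <> E',
      exists u, antipolar E E' u & S = [set E; E']]].
Proof.
apply/seteqP; split=> S [E [E' [eE eE' EE' AE ->]]]; exists E, E'; split=> //.
  have [m [m' [Em Em' /antipodalE[u [u0 [mu mu']]]]]] := AE.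
  exists u; split=> //; split.
    by apply: (midpoint_sub eE Em); exact: mu.
  by apply: (midpoint_sub eE' Em'); exact: mu'.
have [u [u0 [Eu Eu']]] := AE.
have [m [Em mE]] := midpoint_ex eE; have [m' [Em' mE']] := midpoint_ex eE'.
exists m, m'; split=> //; apply/antipodalE; exists u; split=> //.
by split=> z ->; [exact: Eu|exact: Eu'].
Qed.

(** * The defect as an Euler characteristic *)

Definition face_excess F G : int :=
  (nedge F)%:Z * (nedge G)%:Z - ((nvert F)%:Z - 1) * ((nvert G)%:Z - 1).

(** The excess expands to e e' - v v' + v + v' - 1, whose terms have characteristics 2 B, -2 A, V, V
    and -2. *)
Lemma defect_chi : 2 * antipodal_defect P =
  chi (fun u => nz u * face_excess (supp u) (supp (- u))).
Proof.
have fV := finite_vertices a finset.setT; have fE := finite_edges a finset.setT.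
have vE := @chi_count _ _ (fun x => [set x]) fV (fun x vx => vx) vertex_supp.
have vNE := @chi_countN _ _ (fun x => [set x]) fV (fun x vx => vx) vertex_supp.
have vvE := @chi_count_pairs _ _ (fun x => [set x]) fV (fun x vx => vx).
have eeE := @chi_count_pairs _ _ id fE (fun E EE => EE.1).
rewrite -antipodal_vertex_pairsE in vvE; rewrite -antipodal_edge_pairsE in eeE.
pose cv u : int := (nvert (supp u))%:Z; pose ce u : int := (nedge (supp u))%:Z.
have cvE u : cv u = _ := nvert_support a finset.setT u.
have ceE u : ce u = _ := nedge_support a finset.setT u.
rewrite /chi (eq_chi _ (g := fun u => nz u * (ce u * ce (- u))
    - nz u * (cv u * cv (- u)) + nz u * cv u + nz u * cv (- u) - nz u)) => [|u].
  rewrite chiB 2!chiD chiB.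
  have -> := etrans (eq_chi _ (fun u =>
    congr1 (fun c => nz u * c) (f_equal2 *%R (ceE u) (ceE (- u))))) eeE.
  have -> := etrans (eq_chi _ (fun u =>
    congr1 (fun c => nz u * c) (f_equal2 *%R (cvE u) (cvE (- u))))) vvE.
  have -> := etrans (eq_chi _ (fun u =>
    congr1 (fun c => nz u * c) (cvE u))) vE.
  have -> := etrans (eq_chi _ (fun u =>
    congr1 (fun c => nz u * c) (cvE (- u)))) vNE.
  rewrite -/chi chi_nz.
  by rewrite /antipodal_defect /nvert -/P; ring.
by rewrite /face_excess -/(cv u) -/(ce u) -/(cv _) -/(ce _); ring.
Qed.

(** * The defect as a sum over exact opposite pairs *)

Definition pair_excess (S : set (set 'rV[R]_3)) : int :=
  pair_prod (fun F => (nedge F)%:Z) S - pair_prod (fun F => (nvert F)%:Z - 1) S.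

Lemma pair_excessE F G : F <> G -> pair_excess [set F; G] = face_excess F G.
Proof. by move=> FG; rewrite /pair_excess !pair_prodE. Qed.

Lemma finite_exact_pairs : finite_set (exact_pairs P).
Proof.
have fF := finite_faces a finset.setT.
apply: sub_finite_set (finite_image2 (fun F G => [set F; G]) fF fF) => S.
by move=> [F [G [[FP _] [GP _] -> _]]]; exists F => //; exists G.
Qed.

Lemma exact_pairsP S : exact_pairs P S <->
  exists u, u <> 0 /\ S = [set supp u; supp (- u)].
Proof.
split=> [[F [G [_ _ -> [u u1 ->]]]]|[u [u0 ->]]].
  exists u; split=> // u0.
  by move: u1; rewrite /unit_sphere /= u0 dot0l => /eqP;
    rewrite eq_sym oner_eq0.
have Nu0 : - u <> 0 by move=> /eqP; rewrite oppr_eq0 => /eqP.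
have uu := dotuu_gt0 (introN eqP u0); pose c := (Num.sqrt (dot u u))^-1.
have c0 : 0 < c by rewrite invr_gt0 sqrtr_gt0.
exists (supp u), (supp (- u)); split=> //;
  [exact: supp_proper|exact: supp_proper|].
exists (c *: u).
  rewrite /unit_sphere /= dotZl dotZr mulrA -expr2 exprVn sqr_sqrtr ?ltW //.
  by rewrite mulVf // gt_eqF.
by rewrite -scalerN -!/(supp _) !support_faceZ.
Qed.

(* If neither face is a facet, both are vertices or edges, where the excess
   is zero; otherwise the pair of normal cones is a line. *)
Lemma supp_pair_rank u : u <> 0 -> face_excess (supp u) (supp (- u)) <> 0 ->
  \rank (gen_span a (argmax a finset.setT u)
         + gen_span a (argmax a finset.setT (- u)))%MS = 2.
Proof.
move=> u0 ex0; set W := (_ + _)%MS; apply/eqP; rewrite eqn_leq; apply/andP;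
  split.
  (* Both direction spaces are orthogonal to the nonzero [u], which bounds the rank by 2. *)
  have Wu : (W <= kermx u^T)%MS.
    rewrite addsmx_sub; apply/andP; split; apply/gen_spanP => i j iM jM;
    rewrite dot_kermx; apply/eqP;
      first exact: (dot_gen_argmax (gen_sub a iM jM)).
    by have := dot_gen_argmax (gen_sub a iM jM); rewrite dotNl => /eqP;
      rewrite oppr_eq0 => /eqP.
  apply: (leq_trans (mxrankS Wu)); rewrite mxrank_ker mxrank_tr.
  suff -> : \rank u = 1%N by [].
  apply/eqP; rewrite eqn_leq rank_leq_row lt0n mxrank_eq0.
  exact/eqP.
rewrite leqNgt; apply/negP; rewrite ltnS => W1; apply: ex0.
have small v : (gen_span a (argmax a finset.setT v) <= W)%MS ->
    affine_dim (supp v) 0 \/ affine_dim (supp v) 1.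
  move=> /mxrankS vW; have [d dv] := face_dim (supp_face v).
  have dE : d = gen_rank a (argmax a finset.setT v).
    by apply: affine_dim_rank; rewrite -support_hull.
  have := leq_trans vW W1; rewrite -/(gen_rank _ _) -dE.
  by case: d dv {dE} => [|[|//]] dv _; [left|right].
have edge v : affine_dim (supp v) 1 ->
  nedge (supp v) = 1%N /\ nvert (supp v) = 2%N.
  by rewrite /supp support_hull => dv; rewrite nedge_dim1 ?nvert_dim1.
rewrite /face_excess.
have [d0|d1] := small _ (addsmxSl _ _);
  first by rewrite nedge_dim0 // nvert_dim0 // subrr !mul0r.
have [d0'|d1'] := small _ (addsmxSr _ _).
  by rewrite (nedge_dim0 d0') (nvert_dim0 d0') subrr !mulr0.
by have [-> ->] := edge _ d1; have [-> ->] := edge _ d1'.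
Qed.

(** When the excess is nonzero, the pair is attained on two opposite open rays, one for each order
    of its faces; each has codimension 2 and characteristic 1. *)
Lemma chi_exact_pair S : exact_pairs P S ->
  chi (fun u => nz u * ind [set S | [set supp u;
    supp (- u)] = S] S) * pair_excess S =
  2 * pair_excess S.
Proof.
move=> /exact_pairsP[w [w0 ->]]; rewrite pair_excessE; last exact: supp_neq.
have [->|/eqP ex0] := eqVneq (face_excess (supp w) (supp (- w))) 0.
  by rewrite !mulr0.
congr (_ * _).
pose M := argmax a finset.setT.
have MN u : supp u = hull a (M u) := support_hull a finset.setT u.
have Minj u v : (supp u = supp v) <-> (M u = M v).
  by rewrite !MN; exact: hull_inj_argmax.
rewrite /chi (eq_chi _ (g := fun u =>
   ((M u == M w) && (M (- u) == M (- w)))%:R +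
   ((M u == M (- w)) && (M (- u) == M (- (- w))))%:R)) => [|u].
  by rewrite chiD !chi_fan_pair opprK supp_pair_rank // addsmxC supp_pair_rank.
rewrite opprK; have ww : M w <> M (- w) by move=> /Minj; exact: supp_neq.
(* At the origin both summands vanish: equal faces at [0] and [- 0] cannot match the distinct ones
   at [w] and [- w]. *)
have [->|/eqP u0] := eqVneq u 0.
  rewrite /nz [X in X * _]/ind asboolF => [|/(_ erefl)//]; rewrite mul0r oppr0.
  rewrite [(M 0 == M (- w)) && _]andbC.
  by have [e|_] := eqVneq (M 0) (M w); rewrite ?e ?(introF eqP ww).
rewrite /nz [X in X * _]/ind asboolT ?mul1r // /ind.
have -> : `[< [set supp u; supp (- u)] = [set supp w; supp (- w)] >] =
    (M u == M w) && (M (- u) == M (- w)) ||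
    (M u == M (- w)) && (M (- u) == M w).
  apply/asboolP/orP => [/set2_eq[[/Minj-> /Minj->]|[/Minj-> /Minj->]]|].
  - by left; rewrite !eqxx.
  - by right; rewrite !eqxx.
  - by case=> /andP[/eqP/Minj-> /eqP/Minj->] //; rewrite setUC.
by case: eqP => [->|_]; rewrite ?(introF eqP ww) ?addr0 ?orbF ?add0r.
Qed.

(** Each nonzero direction determines one exact pair, so the integrand of [defect_chi] is regrouped
    by pairs and [chi_exact_pair] evaluates every group. *)
Lemma defect_sum : antipodal_defect P =
  \sum_(S <- fset_set (exact_pairs P)) pair_excess S.
Proof.
suff : 2 * antipodal_defect P =
    2 * \sum_(S <- fset_set (exact_pairs P)) pair_excess S by lia.
have fin := finite_exact_pairs.
rewrite defect_chi mulr_sumr -(eq_sum_fset fin chi_exact_pair).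
rewrite /chi (eq_chi _ (g := fun u => \sum_(S <- fset_set (exact_pairs P))
   pair_excess S * (nz u * ind [set S | [set supp u;
     supp (- u)] = S] S))) => [|u].
  rewrite chi_sum; apply: eq_bigr => S _.
  by rewrite chiZ mulrC.
have [->|/eqP u0] := eqVneq u 0.
  rewrite [nz 0](_ : _ = 0) => [|]; last by rewrite /nz /ind asboolF.
  by rewrite mul0r big1 // => S _; rewrite mul0r mulr0.
rewrite [nz u](_ : _ = 1) => [|]; last by rewrite /nz /ind asboolT.
rewrite -pair_excessE; last exact: supp_neq.
transitivity (\sum_(S <- fset_set (exact_pairs P))
   ind [set S | [set supp u; supp (- u)] = S] S * pair_excess [set supp u;
     supp (- u)]).
  rewrite -mulr_suml sum_pred1 // /ind asboolT //.
  by apply/exact_pairsP; exists u.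
apply: eq_bigr => S _; rewrite mul1r mulrC ind_eq.
by case: eqP => [->|_] //; rewrite !mulr0.
Qed.

(** Proper faces have dimension at most 2, and polygons have v = e. An edge and an m-gon give m - (m
    - 1) = 1, an m-gon and an n-gon give m n - (m - 1)(n - 1) = m + n - 1, and all other pairs give
    0. *)
Lemma pair_excess_split S : exact_pairs P S -> pair_excess S =
  ind (exact_EF_pairs P) S +
  ind (exact_FF_pairs P) S * (pair_sum (fun F => (nedge F)%:Z) S - 1).
Proof.
move=> PS; have [w [w0 SE]] := (exact_pairsP S).1 PS.
set F := supp w in SE; set G := supp (- w) in SE.
have FG : F <> G := supp_neq w0.
have FP : faces P F := supp_face w; have GP : faces P G := supp_face (- w).
have Nw0 : - w <> 0 by move=> /eqP; rewrite oppr_eq0 => /eqP.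
have dimlt v d : v <> 0 -> affine_dim (supp v) d -> (d <= 2)%N.
  move=> v0 dv; have := face_dim_le (supp_face v) dv dP.
  rewrite leq_eqVlt => /orP[/eqP d3|//]; rewrite d3 in dv.
  by case: (supp_proper v0) => _ []; exact: face_full (supp_face v) dv dP.
have pgon v : affine_dim (supp v) 2 -> nvert (supp v) = nedge (supp v).
  by rewrite /supp support_hull => /polygon_nvert.
have seg v : affine_dim (supp v) 1 ->
  nedge (supp v) = 1%N /\ nvert (supp v) = 2%N.
  by rewrite /supp support_hull => dv; rewrite nedge_dim1 ?nvert_dim1.
have [d dF] := face_dim FP; have [d' dG] := face_dim GP.
have EFE : exact_EF_pairs P S <-> (d = 1 /\ d' = 2)%N \/ (d = 2 /\ d' = 1)%N.
  split=> [[_ [E' [F' [[EP' dE'] [FP' dF'] SE']]]]|].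
    rewrite SE' in SE; case/set2_eq: SE => [[E1 E2]|[E1 E2]];
      rewrite E1 E2 in dE' dF'.
      by left; split; [exact: affine_dim_uniq FP dF _|
        exact: affine_dim_uniq GP dG _].
    by right; split; [exact: affine_dim_uniq FP dF _|
      exact: affine_dim_uniq GP dG _].
  move=> [[e e']|[e e']]; rewrite e in dF; rewrite e' in dG; split=> //.
    by exists F, G.
  by exists G, F; split=> //; rewrite SE setUC.
have FFE : exact_FF_pairs P S <-> (d = 2 /\ d' = 2)%N.
  split=> [[_ [E' [F' [[EP' dE'] [FP' dF'] SE']]]]|[e e']]; last first.
    by rewrite e in dF; rewrite e' in dG; split=> //; exists F, G.
  rewrite SE' in SE; case/set2_eq: SE => [[E1 E2]|[E1 E2]];
    rewrite E1 E2 in dE' dF'.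
    by split; [exact: affine_dim_uniq FP dF _|exact: affine_dim_uniq GP dG _].
  by split; [exact: affine_dim_uniq FP dF _|exact: affine_dim_uniq GP dG _].
rewrite SE pair_excessE // pair_sumE // -SE /face_excess.
have d2 := dimlt _ _ w0 dF; have d2' := dimlt _ _ Nw0 dG.
have -> : ind (exact_EF_pairs P) S = ((d == 1%N) && (d' == 2%N) || (d == 2%N)
  && (d' == 1%N))%:R.
  rewrite /ind; congr (nat_of_bool _)%:R; apply/asboolP/orP.
    by move=> /EFE[[-> ->]|[-> ->]]; [left|right].
  by case=> /andP[/eqP e /eqP e']; apply/EFE; [left|right].
have -> : ind (exact_FF_pairs P) S = ((d == 2%N) && (d' == 2%N))%:R.
  rewrite /ind; congr (nat_of_bool _)%:R; apply/asboolP/andP.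
    by move=> /FFE[-> ->].
  by case=> /eqP e /eqP e'; apply/FFE.
clear EFE FFE.
case: d dF d2 => [|[|[|//]]] dF _; case: d' dG d2' => [|[|[|//]]] dG _ /=;
  rewrite ?(nedge_dim0 dF) ?(nvert_dim0 dF) ?(nedge_dim0 dG) ?(nvert_dim0 dG)
    ?(pgon _ dF) ?(pgon _ dG) ?(seg _ dF).1 ?(seg _ dF).2 ?(seg _ dG).1 ?(seg _
      dG).2; ring.
Qed.

End FullPolyhedra.

Theorem theorem3p2 (R : realType) (P : set 'rV[R]_3)
    (hP : convex_polyhedron P) :
  antipodal_defect P =
    \sum_(S \in exact_pairs P)
      (pair_prod (fun F => (nedge F)%:Z) S
       - pair_prod (fun F => (nvert F)%:Z - 1) S)
  /\
  antipodal_defect P =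
    (ncard (exact_EF_pairs P))%:Z
    + \sum_(S \in exact_FF_pairs P)
        (pair_sum (fun F => (nedge F)%:Z) S - 1).
Proof.
case: hP => [[k [a ->]]]; rewrite convex_hullE => dP.
have fin := finite_exact_pairs a.
split; first by rewrite fsbig_finite // (defect_sum dP).
set Q := hull a finset.setT in dP fin *.
(* Both families consist of exact pairs, so both sums can be taken over all exact pairs with
   indicators as weights. *)
have EFE : exact_EF_pairs Q = exact_pairs Q `&` exact_EF_pairs Q.
  by apply/seteqP; split=> [S SP|S []//]; split=> //; case: SP.
have FFE : exact_FF_pairs Q = exact_pairs Q `&` exact_FF_pairs Q.
  by apply/seteqP; split=> [S SP|S []//]; split=> //; case: SP.
rewrite EFE FFE ncard_setI // sum_setI // -big_split.
rewrite (defect_sum dP); apply: eq_sum_fset => // S; exact: pair_excess_split.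
Qed.
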